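(* Let $\Bbbk$ be an algebraically closed field, let $G$ be an affine algebraic group over $\Bbbk$, and let $R$ be an associative $\Bbbk$-algebra with $1$ on which $G$ acts rationally by $\Bbbk$-algebra automorphisms. Assume that $R$ satisfies the Nullstellensatz. Then the following conditions are equivalent: (a) $R$ has finitely many $G$-stable semiprime ideals; (b) $G\text{-}\operatorname{Spec}R$ is finite; (c) $G\text{-}\operatorname{Rat}R$ is finite; (d) $G$ has finitely many orbits in $\operatorname{Rat}R$; (e) $R$ satisfies (i) the ascending chain condition for $G$-stable semiprime ideals, (ii) the Dixmier-Mœglin equivalence, and (iii) $G\text{-}\operatorname{Rat}R=G\text{-}\operatorname{Spec}R$. If these conditions are satisfied, then the rational ideals of $R$ are exactly the primes of $R$ that are maximal in their $G$-strata.
   Context: The action of $G$ on $R$ is rational if $R$ is a union of finite-dimensional $G$-stable subspaces $V$ on each of which $G$ acts via a homomorphism of algebraic groups $G\to \operatorname{GL}(V)$. Extended centroid: for a ring $U$, let $\mathcal E$ be the filter of all two-sided ideals $I$ of $U$ with zero left annihilator $\{u\in U\mid uI=0\}$; the (right) Amitsur-Martindale ring of quotients of $U$ is $\varinjlim_{I\in\mathcal E}\operatorname{Hom}(I_U,U_U)$, and the extended centroid $\mathcal C(U)$ is its center. A group acting by automorphisms on $U$ acts, by unique extension, on $\mathcal C(U)$. $\operatorname{Spec} R$ is the set of prime ideals of $R$ with the Jacobson-Zariski topology: closed sets are $\{P\in\operatorname{Spec}R\mid P\supseteq I\}$ for $I\subseteq R$. Semiprime ideals are intersections of prime ideals. A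 prime $P$ is rational if $\mathcal C(R/P)=\Bbbk$; $\operatorname{Rat}R$ is the set of rational ideals, on which $G$ acts. A prime $P$ is locally closed if $\{P\}$ is open in its closure in $\operatorname{Spec}R$, equivalently $P\ne\bigcap_{Q\in\operatorname{Spec}R,\,Q\supsetneqq P}Q$. A proper $G$-stable ideal $I$ of $R$ is $G$-prime if $AB\subseteq I$ for $G$-stable ideals $A,B$ of $R$ implies $A\subseteq I$ or $B\subseteq I$. $G\text{-}\operatorname{Spec}R$ is the set of $G$-prime ideals; $G\text{-}\operatorname{Rat}R$ is the subset of $G$-rational ideals, i.e. those $I\in G\text{-}\operatorname{Spec}R$ with $\mathcal C(R/I)^G=\Bbbk$. For $I\in G\text{-}\operatorname{Spec}R$, the $G$-stratum over $I$ is $\operatorname{Spec}_IR=\{P\in\operatorname{Spec}R\mid\bigcap_{g\in G}g.P=I\}$; these strata partition $\operatorname{Spec}R$. An ideal is primitive if it is the annihilator of a simple (right) $R$-module. $R$ satisfies the Nullstellensatz if (1) every prime ideal of $R$ is an intersection of primitive ideals, and (2) the center of $\operatorname{End}_R(V)$ equals $\Bbbk$ for every simple $R$-module $V$. $R$ satisfies the Dixmier-Mœglin equivalence if for every prime ideal of $R$ the properties ''locally closed in $\operatorname{Spec}R$'', ''primitive'' and ''rational'' are equivalent. *)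

(* Defs.v *)
From HB Require Import structures.
From mathcomp Require Import all_boot all_algebra.
From mathcomp Require Import boolp classical_sets cardinality topology_structure.
From mathcomp Require Import mpoly.

Set Implicit Arguments.
Unset Strict Implicit.
Unset Printing Implicit Defensive.

Import GRing.Theory.

Local Open Scope classical_set_scope.
Local Open Scope ring_scope.
Local Open Scope quotient_scope.

(* Over an algebraically closed field an affine algebraic group is identified
   with its group of rational points: a group whose elements are the points of
   a Zariski closed subset of some affine space, multiplication and inversion
   being polynomial in the coordinates. *)

Definition pair_coord (T : Type) (m n : nat) (x : 'I_m -> T) (y : 'I_n -> T)
    (l : 'I_(m + n)) : T :=
  match split l with inl i => x i | inr j => y j end.

Record affine_group (k : fieldType) := AffineGroup {
  ag_group :> groupType;
  ag_dim : nat;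
  ag_coord : ag_group -> 'I_ag_dim -> k;
  ag_coord_inj : injective ag_coord;
  ag_closed : exists E : set {mpoly k[ag_dim]},
    range ag_coord = [set x | forall p, E p -> p.@[x] = 0];
  ag_mul : forall i, exists p : {mpoly k[ag_dim + ag_dim]}, forall g h,
    ag_coord (g * h)%g i = p.@[pair_coord (ag_coord g) (ag_coord h)];
  ag_inv : forall i, exists p : {mpoly k[ag_dim]}, forall g,
    ag_coord g^-1%g i = p.@[ag_coord g] }.

Definition regular_fun (k : fieldType) (G : affine_group k) (f : G -> k) :=
  exists p : {mpoly k[ag_dim G]}, forall g, f g = p.@[ag_coord g].

(* The coordinate ring of GL_n is generated by the entries and 1/det. *)
Definition alg_group_hom_GL (k : fieldType) (G : affine_group k) (n : nat)
    (rho : G -> 'M[k]_n) :=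
  [/\ rho 1%g = 1%:M,
      forall g h, rho (g * h)%g = rho g *m rho h,
      forall i j, regular_fun (fun g => rho g i j) &
      regular_fun (fun g => (\det (rho g))^-1)].

Identity Coercion fun_of_set : set >-> Funclass.

Record ideal (U : pzRingType) := Ideal {
  ideal_set :> set U;
  ideal0 : ideal_set 0;
  idealD : forall x y, ideal_set x -> ideal_set y -> ideal_set (x + y);
  idealMl : forall u x, ideal_set x -> ideal_set (u * x);
  idealMr : forall x u, ideal_set x -> ideal_set (x * u) }.

Section IdealTheory.
Variable U : pzRingType.
Implicit Types I J K : ideal U.

Lemma idealN I x : I x -> I (- x).
Proof. by rewrite -mulN1r; apply: idealMl. Qed.

Lemma idealB I x y : I x -> I y -> I (x - y).
Proof. by move=> Ix Iy; apply: idealD => //; apply: idealN. Qed.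

Lemma ideal_eq I J : I = J :> set U -> I = J.
Proof.
case: I J => [I I0 ID Il Ir] [J J0 JD Jl Jr] /= IJ; case: J / IJ J0 JD Jl Jr.
by move=> *; congr Ideal; apply: Prop_irrelevance.
Qed.

Lemma ideal_sum I n (F : 'I_n -> U) :
  (forall i, I (F i)) -> I (\sum_(i < n) F i).
Proof.
by move=> IF; apply: (big_ind I) => //; [exact: ideal0 | exact: idealD].
Qed.

Definition idealT : ideal U.
Proof. by refine (@Ideal U setT _ _ _ _). Defined.

Definition idealI I J : ideal U.
Proof.
refine (@Ideal U (I `&` J) _ _ _ _).
- by split; apply: ideal0.
- by move=> x y [? ?] [? ?]; split; apply: idealD.
- by move=> u x [? ?]; split; apply: idealMl.
- by move=> u x [? ?]; split; apply: idealMr.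
Defined.

Definition ideal_mul I J : ideal U.
Proof.
refine (@Ideal U [set x | exists n (a b : 'I_n -> U),
  [/\ forall i, I (a i), forall i, J (b i) & x = \sum_(i < n) a i * b i]]
  _ _ _ _).
- by exists 0%N, (fun=> 0), (fun=> 0); split;
    rewrite ?big_ord0 // => i; apply: ideal0.
- move=> _ _ [m [a [b [Ia Jb ->]]]] [n [c [d [Ic Jd ->]]]].
  exists (m + n)%N, (pair_coord a c), (pair_coord b d); split=> [i|i|].
  + by rewrite /pair_coord; case: split.
  + by rewrite /pair_coord; case: split.
  + rewrite big_split_ord /pair_coord /=; congr (_ + _); apply: eq_bigr => i _.
      by rewrite (unsplitK (inl i)).
    by rewrite (unsplitK (inr i)).
- move=> u _ [n [a [b [Ia Jb ->]]]]; exists n, (fun i => u * a i), b.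
  split=> // [i|]; first exact: idealMl.
  by rewrite mulr_sumr; apply: eq_bigr => i _; rewrite mulrA.
- move=> _ u [n [a [b [Ia Jb ->]]]]; exists n, a, (fun i => b i * u).
  split=> // [i|]; first exact: idealMr.
  by rewrite mulr_suml; apply: eq_bigr => i _; rewrite mulrA.
Defined.

Lemma ideal_mulW I J x y : I x -> J y -> ideal_mul I J (x * y).
Proof.
by move=> Ix Jy; exists 1%N, (fun=> x), (fun=> y); split; rewrite ?big_ord1.
Qed.

Lemma ideal_mul_subl I J : ideal_mul I J `<=` I.
Proof.
by move=> _ [n [a [b [Ia Jb ->]]]]; apply: ideal_sum => i; apply: idealMr.
Qed.

Lemma ideal_mul_subr I J : ideal_mul I J `<=` J.
Proof.
by move=> _ [n [a [b [Ia Jb ->]]]]; apply: ideal_sum => i; apply: idealMl.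
Qed.

Lemma ideal_mul_sub I J K :
  (forall x y, I x -> J y -> K (x * y)) -> ideal_mul I J `<=` K.
Proof.
by move=> IJK _ [n [a [b [Ia Jb ->]]]]; apply: ideal_sum => i; apply: IJK.
Qed.

Definition ideal_gen (S : set U) : ideal U.
Proof.
refine (@Ideal U [set x | forall I, S `<=` I -> I x] _ _ _ _).
- by move=> I _; apply: ideal0.
- by move=> x y Sx Sy I SI; apply: idealD; [apply: Sx | apply: Sy].
- by move=> u x Sx I SI; apply: idealMl; apply: Sx.
- by move=> x u Sx I SI; apply: idealMr; apply: Sx.
Defined.

Lemma ideal_gen_sub S I : (ideal_gen S `<=` I) <-> (S `<=` I).
Proof.
split=> [SI x Sx|SI x]; last exact.
by apply: SI => J; apply.
Qed.

End IdealTheory.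

Definition ideal_pred (U : pzRingType) (I : ideal U) : {pred U} :=
  fun x => `[< I x >].

Lemma ideal_pred_zmod_closed (U : pzRingType) (I : ideal U) :
  zmod_closed (ideal_pred I).
Proof.
by split=> [|x y /asboolP Ix /asboolP Iy]; apply/asboolP;
  [apply: ideal0 | apply: idealB].
Qed.
HB.instance Definition _ (U : pzRingType) (I : ideal U) :=
  GRing.isZmodClosed.Build U (ideal_pred I) (ideal_pred_zmod_closed I).

Definition quot_ring (U : pzRingType) (I : ideal U) : Type :=
  {ideal_quot ideal_pred I}.
HB.instance Definition _ (U : pzRingType) (I : ideal U) :=
  GRing.Zmodule.on (quot_ring I).

Section QuotRing.
Variables (U : pzRingType) (I : ideal U).
Local Notation Q := (quot_ring I).

Definition quot_proj (u : U) : Q := \pi_{ideal_quot ideal_pred I} u.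

Lemma quot_projP u v : quot_proj u = quot_proj v <-> I (u - v).
Proof.
rewrite /quot_proj; split=> [/eqP|Iuv].
  by rewrite -Quotient.idealrBE => /asboolP.
by apply/eqP; rewrite -Quotient.idealrBE; apply/asboolP.
Qed.

Lemma quot_projK (q : Q) : quot_proj (repr q) = q.
Proof. exact: reprK. Qed.

Lemma quot_proj_is_zmod_morphism : zmod_morphism quot_proj.
Proof. exact: pi_is_zmod_morphism. Qed.
HB.instance Definition _ :=
  GRing.isZmodMorphism.Build U Q quot_proj quot_proj_is_zmod_morphism.

Definition quot_one : Q := quot_proj 1.
Definition quot_mul (p q : Q) : Q := quot_proj (repr p * repr q).

Lemma quot_projM u v : quot_proj (u * v) = quot_mul (quot_proj u) (quot_proj v).
Proof.
apply/quot_projP; set u' := repr _; set v' := repr _.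
have -> : u * v - u' * v' = (u - u') * v + u' * (v - v').
  by rewrite mulrBl mulrBr addrA subrK.
apply: idealD; [apply: idealMr | apply: idealMl].
  by apply/quot_projP; rewrite quot_projK.
by apply/quot_projP; rewrite quot_projK.
Qed.

Lemma quot_mulA : associative quot_mul.
Proof.
move=> p q r; rewrite -[p]quot_projK -[q]quot_projK -[r]quot_projK.
by rewrite -!quot_projM mulrA.
Qed.
Lemma quot_mul1q : left_id quot_one quot_mul.
Proof. by move=> p; rewrite -[p]quot_projK -quot_projM mul1r. Qed.
Lemma quot_mulq1 : right_id quot_one quot_mul.
Proof. by move=> p; rewrite -[p]quot_projK -quot_projM mulr1. Qed.
Lemma quot_mulDl : left_distributive quot_mul +%R.
Proof.
move=> p q r; rewrite -[p]quot_projK -[q]quot_projK -[r]quot_projK.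
by rewrite -raddfD -!quot_projM mulrDl raddfD.
Qed.
Lemma quot_mulDr : right_distributive quot_mul +%R.
Proof.
move=> p q r; rewrite -[p]quot_projK -[q]quot_projK -[r]quot_projK.
by rewrite -raddfD -!quot_projM mulrDr raddfD.
Qed.

HB.instance Definition _ := GRing.Zmodule_isPzRing.Build Q
  quot_mulA quot_mul1q quot_mulq1 quot_mulDl quot_mulDr.

Lemma quot_proj_is_monoid_morphism : monoid_morphism quot_proj.
Proof. by split=> // u v; apply: quot_projM. Qed.
HB.instance Definition _ :=
  GRing.isMonoidMorphism.Build U Q quot_proj quot_proj_is_monoid_morphism.

End QuotRing.

Definition left_ann (U : pzRingType) (S : set U) : set U :=
  [set u | forall x, S x -> u * x = 0].

Definition dense_ideal (U : pzRingType) (I : ideal U) :=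
  left_ann I = [set 0].

(* A right U-linear map from a dense ideal to U; the values of [dh_fun] outside
   the domain are irrelevant, being forgotten by the direct limit below. *)
Record dense_hom (U : pzRingType) := DenseHom {
  dh_dom : ideal U;
  dh_dense : dense_ideal dh_dom;
  dh_fun :> U -> U;
  dh_add : forall x y, dh_dom x -> dh_dom y ->
    dh_fun (x + y) = dh_fun x + dh_fun y;
  dh_mulr : forall x u, dh_dom x -> dh_fun (x * u) = dh_fun x * u }.

HB.instance Definition _ (U : pzRingType) := gen_eqMixin (dense_hom U).
HB.instance Definition _ (U : pzRingType) := gen_choiceMixin (dense_hom U).

Section Martindale.
Variable U : pzRingType.
Implicit Types (I J K : ideal U) (f g h : dense_hom U).

Lemma dense_idealP I :
  dense_ideal I <-> (forall u, (forall x, I x -> u * x = 0) -> u = 0).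
Proof.
split=> [dI u uI|dI]; first by rewrite -[u = 0]/([set 0] u) -dI.
apply/seteqP; split=> [u uI|_ -> x _]; first exact: dI.
by rewrite mul0r.
Qed.

Lemma denseT : dense_ideal (idealT U).
Proof. by apply/dense_idealP => u /(_ 1 Logic.I); rewrite mulr1. Qed.

Lemma denseM I J :
  dense_ideal I -> dense_ideal J -> dense_ideal (ideal_mul I J).
Proof.
move=> /dense_idealP dI /dense_idealP dJ; apply/dense_idealP => u uIJ.
apply: dI => x Ix; apply: dJ => y Jy; rewrite -mulrA; apply: uIJ.
exact: ideal_mulW.
Qed.

Lemma dense_sub I J : I `<=` J -> dense_ideal I -> dense_ideal J.
Proof.
move=> IJ /dense_idealP dI; apply/dense_idealP => u uJ.
by apply: dI => x /IJ; apply: uJ.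
Qed.

Lemma denseI I J : dense_ideal I -> dense_ideal J -> dense_ideal (idealI I J).
Proof.
move=> dI dJ; apply: (dense_sub _ (denseM dI dJ)) => x IJx.
by split; [apply: ideal_mul_subl IJx | apply: ideal_mul_subr IJx].
Qed.

Lemma dh0 f : f 0 = 0.
Proof. by rewrite -(mul0r 0) dh_mulr ?mulr0 //; apply: ideal0. Qed.

Lemma dh_ideal_mul f I x : ideal_mul I (dh_dom f) x -> dh_dom f x.
Proof. exact: ideal_mul_subr. Qed.

Lemma dh_mul_dom f I x : ideal_mul (dh_dom f) I x -> I (f x).
Proof.
move=> [n [a [b [fa Ib ->]]]].
suff [] : dh_dom f (\sum_(i < n) a i * b i) /\ I (f (\sum_(i < n) a i * b i)).
  by [].
apply: (big_ind (fun x => dh_dom f x /\ I (f x))).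
- by rewrite dh0; split; apply: ideal0.
- by move=> y z [fy Iy] [fz Iz]; rewrite dh_add //; split; apply: idealD.
- by move=> i _; rewrite dh_mulr //; split; [apply: idealMr | apply: idealMl].
Qed.

Definition dh_eqv f g : bool :=
  `[< exists K, [/\ dense_ideal K, K `<=` dh_dom f, K `<=` dh_dom g &
        forall x, K x -> f x = g x] >].

Lemma dh_eqvW f g :
  (forall x, dh_dom f x -> dh_dom g x -> f x = g x) -> dh_eqv f g.
Proof.
move=> fg; apply/asboolP; exists (idealI (dh_dom f) (dh_dom g)).
split=> [|x []|x []|x [fx gx]] //; last exact: fg.
by apply: denseI; apply: dh_dense.
Qed.

Lemma dh_eqvP f g :
  reflect (forall x, dh_dom f x -> dh_dom g x -> f x = g x) (dh_eqv f g).
Proof.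
apply: (iffP idP) => [/asboolP[K [/dense_idealP dK _ _ fg]] x fx gx|]; last first.
  exact: dh_eqvW.
apply/eqP; rewrite -subr_eq0; apply/eqP; apply: dK => y Ky.
rewrite mulrBl -!dh_mulr // fg ?subrr //.
exact: idealMl.
Qed.

Lemma dh_eqv_equiv : equiv_class_of dh_eqv.
Proof.
split=> [f|f g|g f h].
- exact/dh_eqvP.
- by apply/dh_eqvP/dh_eqvP => fg x gx fx; rewrite fg.
move=> /asboolP[K [dK Kf Kg fg]] /asboolP[L [dL Lg Lh gh]].
apply/asboolP; exists (idealI K L).
split=> [|x [? _]|x [_ ?]|x [Kx Lx]]; [exact: denseI|exact: Kf|exact: Lh|].
by rewrite fg // gh.
Qed.

Canonical dh_eqv_equivRel := EquivRelPack dh_eqv_equiv.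
Canonical dh_eqv_encModRel := defaultEncModRel dh_eqv.

Definition dh_const0 : dense_hom U.
Proof.
by refine (@DenseHom U (idealT U) denseT (fun=> 0) _ _) => *;
  rewrite ?addr0 ?mul0r.
Defined.

Definition dh_lmul (u : U) : dense_hom U.
Proof.
by refine (@DenseHom U (idealT U) denseT (fun x => u * x) _ _) => *;
  rewrite ?mulrDr ?mulrA.
Defined.

Definition dh_opp f : dense_hom U.
Proof.
refine (@DenseHom U (dh_dom f) (dh_dense f) (fun x => - f x) _ _).
- by move=> x y fx fy; rewrite dh_add // opprD.
- by move=> x u fx; rewrite dh_mulr // mulNr.
Defined.

Definition dh_plus f g : dense_hom U.
Proof.
refine (@DenseHom U (idealI (dh_dom f) (dh_dom g))
          (denseI (dh_dense f) (dh_dense g)) (fun x => f x + g x) _ _).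
- by move=> x y [fx gx] [fy gy]; rewrite !dh_add // addrACA.
- by move=> x u [fx gx]; rewrite !dh_mulr // mulrDl.
Defined.

(* g maps (dom g)(dom f) into dom f, so f \o g is defined there. *)
Definition dh_comp f g : dense_hom U.
Proof.
refine (@DenseHom U (ideal_mul (dh_dom g) (dh_dom f))
          (denseM (dh_dense g) (dh_dense f)) (f \o g) _ _).
- move=> x y gfx gfy /=; rewrite !dh_add //; try exact: dh_mul_dom.
    exact: ideal_mul_subl gfx.
  exact: ideal_mul_subl gfy.
- move=> x u gfx /=; rewrite !dh_mulr //; first exact: dh_mul_dom.
  exact: ideal_mul_subl gfx.
Defined.

(* The direct limit of Hom(I_U, U_U) over the dense ideals I. *)
Definition martindale := {eq_quot dh_eqv}.
HB.instance Definition _ := Choice.on martindale.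

Definition mart_class f : martindale := \pi_martindale f.

Lemma mart_classP f g :
  mart_class f = mart_class g <->
  (forall x, dh_dom f x -> dh_dom g x -> f x = g x).
Proof. by split=> [/eqmodP/dh_eqvP|/dh_eqvP/eqmodP]. Qed.

Lemma mart_classK (p : martindale) : mart_class (repr p) = p.
Proof. exact: reprK. Qed.

Definition mart_zero := mart_class dh_const0.
Definition mart_one := mart_class (dh_lmul 1).
Definition mart_opp (p : martindale) := mart_class (dh_opp (repr p)).
Definition mart_add (p q : martindale) :=
  mart_class (dh_plus (repr p) (repr q)).
Definition mart_mul (p q : martindale) :=
  mart_class (dh_comp (repr p) (repr q)).

Lemma repr_martE f x :
  dh_dom (repr (mart_class f)) x -> dh_dom f x -> repr (mart_class f) x = f x.
Proof.
move=> rx fx.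
by have /mart_classP -> // := mart_classK (mart_class f).
Qed.

Lemma mart_oppE f : mart_opp (mart_class f) = mart_class (dh_opp f).
Proof. by apply/mart_classP => x ? ?; rewrite /= repr_martE. Qed.

Lemma mart_addE f g :
  mart_add (mart_class f) (mart_class g) = mart_class (dh_plus f g).
Proof. by apply/mart_classP => x [? ?] [? ?]; rewrite /= !repr_martE. Qed.

Lemma mart_mulE f g :
  mart_mul (mart_class f) (mart_class g) = mart_class (dh_comp f g).
Proof.
apply/mart_classP => x rx fgx; have gE : repr (mart_class g) x = g x.
  by apply: repr_martE; [apply: ideal_mul_subl rx | apply: ideal_mul_subl fgx].
rewrite /= gE repr_martE //; last exact: dh_mul_dom fgx.
by rewrite -gE; apply: dh_mul_dom rx.
Qed.

Lemma mart_addA : associative mart_add.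
Proof.
move=> p q r; rewrite -[p]mart_classK -[q]mart_classK -[r]mart_classK.
by rewrite !mart_addE; apply/mart_classP => x _ _ /=; rewrite addrA.
Qed.
Lemma mart_addC : commutative mart_add.
Proof. by move=> p q; apply/mart_classP => x _ _ /=; rewrite addrC. Qed.
Lemma mart_add0 : left_id mart_zero mart_add.
Proof.
move=> p; rewrite -[p]mart_classK mart_addE.
by apply/mart_classP => x _ _ /=; rewrite add0r.
Qed.
Lemma mart_addN : left_inverse mart_zero mart_opp mart_add.
Proof.
move=> p; rewrite -[p]mart_classK mart_oppE mart_addE.
by apply/mart_classP => x _ _ /=; rewrite addNr.
Qed.
HB.instance Definition _ := GRing.isZmodule.Build martindale
  mart_addA mart_addC mart_add0 mart_addN.

Lemma mart_mulA : associative mart_mul.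
Proof.
move=> p q r; rewrite -[p]mart_classK -[q]mart_classK -[r]mart_classK.
by rewrite !mart_mulE; apply/mart_classP.
Qed.
Lemma mart_mul1q : left_id mart_one mart_mul.
Proof.
move=> p; rewrite -[p]mart_classK mart_mulE.
by apply/mart_classP => x _ _ /=; rewrite mul1r.
Qed.
Lemma mart_mulq1 : right_id mart_one mart_mul.
Proof.
move=> p; rewrite -[p]mart_classK mart_mulE.
by apply/mart_classP => x _ _ /=; rewrite mul1r.
Qed.
Lemma mart_mulDl : left_distributive mart_mul mart_add.
Proof.
move=> p q r; rewrite -[p]mart_classK -[q]mart_classK -[r]mart_classK.
by rewrite mart_addE !mart_mulE mart_addE; apply/mart_classP.
Qed.
Lemma mart_mulDr : right_distributive mart_mul mart_add.
Proof.
move=> p q r; rewrite -[p]mart_classK -[q]mart_classK -[r]mart_classK.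
rewrite mart_addE !mart_mulE mart_addE.
apply/mart_classP => x _ [pqx prx] /=.
by rewrite dh_add //; apply: dh_mul_dom.
Qed.
HB.instance Definition _ := GRing.Zmodule_isPzRing.Build martindale
  mart_mulA mart_mul1q mart_mulq1 mart_mulDl mart_mulDr.

Definition mart_embed (u : U) : martindale := mart_class (dh_lmul u).

Definition extended_centroid : set martindale :=
  [set q | forall p : martindale, q * p = p * q].

End Martindale.

Arguments extended_centroid U : clear implicits.

Record ring_action (G : groupType) (U : pzRingType) := RingAction {
  act :> G -> {rmorphism U -> U};
  act1 : forall u, act 1%g u = u;
  actM : forall g h u, act (g * h)%g u = act g (act h u) }.

Section Action.
Variables (G : groupType) (U : pzRingType) (A : ring_action G U).

Lemma actK g : cancel (A g) (A g^-1%g).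
Proof. by move=> u; rewrite -actM mulVg act1. Qed.

Lemma actVK g : cancel (A g^-1%g) (A g).
Proof. by move=> u; rewrite -actM mulgV act1. Qed.

Definition fixed_points : set U := [set u | forall g, A g u = u].

Definition act_ideal (g : G) (I : ideal U) : ideal U.
Proof.
refine (@Ideal U (A g @` I) _ _ _ _).
- by exists 0; rewrite ?raddf0 //; apply: ideal0.
- move=> _ _ [x Ix <-] [y Iy <-].
  by exists (x + y); rewrite ?rmorphD //; apply: idealD.
- move=> u _ [x Ix <-]; exists (A g^-1%g u * x); first exact: idealMl.
  by rewrite rmorphM actVK.
- move=> _ u [x Ix <-]; exists (x * A g^-1%g u); first exact: idealMr.
  by rewrite rmorphM actVK.
Defined.

Lemma act_idealP g (I : ideal U) x : act_ideal g I x <-> I (A g^-1%g x).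
Proof.
split=> [[y Iy <-]|Ix]; first by rewrite actK.
by exists (A g^-1%g x); rewrite ?actVK.
Qed.

Lemma act_ideal_sub g (I J : ideal U) :
  (act_ideal g I `<=` J) <-> (I `<=` act_ideal g^-1%g J).
Proof.
split=> [IJ x Ix|IJ _ [x Ix <-]].
  by apply/act_idealP; rewrite invgK; apply: IJ; exists x.
by have /act_idealP := IJ _ Ix; rewrite invgK.
Qed.

Record gideal := GIdeal {
  gideal_ideal :> ideal U;
  gideal_stable : forall g x, gideal_ideal x -> gideal_ideal (A g x) }.

Section QuotAction.
Variable I : gideal.

Definition quot_act (g : G) (q : quot_ring I) : quot_ring I :=
  quot_proj I (A g (repr q)).

Lemma quot_actE g u : quot_act g (quot_proj I u) = quot_proj I (A g u).
Proof.
apply/quot_projP; rewrite -rmorphB; apply: gideal_stable.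
by apply/quot_projP; rewrite quot_projK.
Qed.

Lemma quot_act_is_zmod_morphism g : zmod_morphism (quot_act g).
Proof.
move=> p q; rewrite -[p]quot_projK -[q]quot_projK -rmorphB !quot_actE.
by rewrite -!rmorphB.
Qed.
HB.instance Definition _ g := GRing.isZmodMorphism.Build
  (quot_ring I) (quot_ring I) (quot_act g) (quot_act_is_zmod_morphism g).

Lemma quot_act_is_monoid_morphism g : monoid_morphism (quot_act g).
Proof.
split; first by rewrite -(rmorph1 (quot_proj I)) quot_actE !rmorph1.
move=> p q; rewrite -[p]quot_projK -[q]quot_projK -rmorphM !quot_actE.
by rewrite -!rmorphM.
Qed.
HB.instance Definition _ g := GRing.isMonoidMorphism.Build
  (quot_ring I) (quot_ring I) (quot_act g) (quot_act_is_monoid_morphism g).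

Definition quot_action : ring_action G (quot_ring I).
Proof.
refine (@RingAction _ _ (fun g => quot_act g : {rmorphism _ -> _}) _ _).
- by move=> q; rewrite -[q]quot_projK /= quot_actE act1.
- by move=> g h q; rewrite -[q]quot_projK /= !quot_actE actM.
Defined.

End QuotAction.

Lemma dense_act g (I : ideal U) : dense_ideal I -> dense_ideal (act_ideal g I).
Proof.
move=> /dense_idealP dI; apply/dense_idealP => u uI.
rewrite -[u](actVK g) (dI (A g^-1%g u)) ?rmorph0 // => x Ix.
rewrite -[x](actK g) -rmorphM uI ?rmorph0 //.
by exists x.
Qed.

Definition dh_act (g : G) (f : dense_hom U) : dense_hom U.
Proof.
refine (@DenseHom U (act_ideal g (dh_dom f)) (dense_act g (dh_dense f))
  (fun x => A g (f (A g^-1%g x))) _ _).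
- move=> x y /act_idealP fx /act_idealP fy.
  by rewrite rmorphD dh_add // rmorphD.
- by move=> x u /act_idealP fx; rewrite rmorphM dh_mulr // rmorphM actVK.
Defined.

(* The unique extension of the action of G to the ring of quotients, see
   [mart_act_embed] below; it stabilizes the extended centroid. *)
Definition mart_act (g : G) (q : martindale U) : martindale U :=
  mart_class (dh_act g (repr q)).

Lemma mart_actE g f : mart_act g (mart_class f) = mart_class (dh_act g f).
Proof.
apply/mart_classP => x /act_idealP rx /act_idealP fx /=.
by rewrite repr_martE.
Qed.

Lemma mart_act_is_zmod_morphism g : zmod_morphism (mart_act g).
Proof.
move=> p q; rewrite -[p]mart_classK -[q]mart_classK.
rewrite -[mart_class _ - _]/(mart_add _ (mart_opp _)).
rewrite -[RHS]/(mart_add _ (mart_opp _)).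
rewrite mart_oppE mart_addE !mart_actE mart_oppE mart_addE.
by apply/mart_classP => x _ _ /=; rewrite rmorphB.
Qed.
HB.instance Definition _ g := GRing.isZmodMorphism.Build
  (martindale U) (martindale U) (mart_act g) (mart_act_is_zmod_morphism g).

Lemma mart_act_is_monoid_morphism g : monoid_morphism (mart_act g).
Proof.
split.
  rewrite -[1]/(mart_class (dh_lmul 1)) mart_actE.
  by apply/mart_classP => x _ _ /=; rewrite !mul1r actVK.
move=> p q; rewrite -[p]mart_classK -[q]mart_classK.
rewrite -[_ * _]/(mart_mul _ _) -[RHS]/(mart_mul _ _).
rewrite mart_mulE !mart_actE mart_mulE.
by apply/mart_classP => x _ _ /=; rewrite actK.
Qed.
HB.instance Definition _ g := GRing.isMonoidMorphism.Build
  (martindale U) (martindale U) (mart_act g) (mart_act_is_monoid_morphism g).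

Definition mart_action : ring_action G (martindale U).
Proof.
refine (@RingAction _ _ (fun g => mart_act g : {rmorphism _ -> _}) _ _).
- move=> q; rewrite -[q]mart_classK /= mart_actE.
  apply/mart_classP => x _ _ /=.
  by rewrite act1 -{1}[x](act1 A) actK.
- move=> g h q; rewrite -[q]mart_classK /= !mart_actE.
  by apply/mart_classP => x _ _ /=; rewrite invgM !actM.
Defined.

Lemma mart_act_embed g u : mart_act g (mart_embed u) = mart_embed (A g u).
Proof.
rewrite mart_actE; apply/mart_classP => x _ _ /=.
by rewrite rmorphM actVK.
Qed.

End Action.

Arguments fixed_points {G U} A.

Section Spec.
Variable U : pzRingType.

Definition prime_ideal (P : ideal U) :=
  P <> setT :> set U /\
  forall I J : ideal U, ideal_mul I J `<=` P -> I `<=` P \/ J `<=` P.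

Record spec := Spec {
  spec_ideal :> ideal U;
  spec_prime : prime_ideal spec_ideal }.

HB.instance Definition _ := gen_eqMixin spec.
HB.instance Definition _ := gen_choiceMixin spec.

Definition zero_locus (S : set U) : set spec := [set P : spec | S `<=` P].

Definition zariski_open (O : set spec) := exists S, ~` O = zero_locus S.

Lemma zariski_openT : zariski_open setT.
Proof.
exists setT; rewrite setCT; apply/seteqP; split=> // P TP.
by case: (spec_prime P) => + _; apply; apply/seteqP; split.
Qed.

Lemma zariski_openI : setI_closed zariski_open.
Proof.
move=> O1 O2 [S1 O1E] [S2 O2E].
exists (ideal_mul (ideal_gen S1) (ideal_gen S2)); rewrite setCI O1E O2E.
apply/seteqP; split=> P.
  case=> SP x; [move/ideal_mul_subl | move/ideal_mul_subr]; apply; exact: SP.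
have [_ Pprime] := spec_prime P.
by move=> /Pprime [] SP; [left | right]; move=> x Sx; apply: SP => I; apply.
Qed.

Lemma zariski_open_bigU (T : Type) (f : T -> set spec) :
  (forall i, zariski_open (f i)) -> zariski_open (\bigcup_i f i).
Proof.
move=> /choice[S fE]; exists (\bigcup_i S i); rewrite setC_bigcup.
apply/seteqP; split=> [P fP x [i _ Six]|P SP i _].
  by have := fP i Logic.I; rewrite fE; apply.
by rewrite fE => x Six; apply: SP; exists i.
Qed.

HB.instance Definition _ := isOpenTopological.Build spec
  zariski_openT zariski_openI zariski_open_bigU.

Lemma open_specE (O : set spec) : open O = zariski_open O.
Proof. by []. Qed.

Definition locally_closed (P : spec) :=
  exists O : set spec, open O /\ O `&` closure [set P] = [set P].

(* The empty intersection is allowed: the whole ring counts as semiprime. *)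
Definition semiprime_ideal (I : ideal U) :=
  exists S : set spec, ideal_set I = \bigcap_(P in S) (P : set U).

(* A right U-module is a left module over the opposite ring U^c. *)
Definition simple_module (V : lmodType U^c) :=
  (exists v : V, v != 0) /\
  forall W : {pred V}, submod_closed W -> W =i pred1 0 \/ W =i predT.

Definition module_ann (V : lmodType U^c) : set U :=
  [set u | forall v : V, (u : U^c) *: v = 0].

Definition primitive_ideal (I : ideal U) :=
  exists V : lmodType U^c, simple_module V /\ ideal_set I = module_ann V.

End Spec.

Section ActionSpec.
Variables (G : groupType) (U : pzRingType) (A : ring_action G U).

Lemma act_ideal_prime g (P : spec U) : prime_ideal (act_ideal A g P).
Proof.
have [PT Pprime] := spec_prime P; split=> [gPT|I J IJP].
  apply: PT; apply/seteqP; split=> // x _.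
  have : act_ideal A g P (A g x) by rewrite gPT.
  by move/act_idealP; rewrite actK.
have : ideal_mul (act_ideal A g^-1%g I) (act_ideal A g^-1%g J) `<=` P.
  apply: ideal_mul_sub => _ _ [x Ix <-] [y Jy <-]; rewrite -rmorphM.
  by apply/act_idealP; apply: IJP; apply: ideal_mulW.
by case/Pprime => /act_ideal_sub; rewrite invgK; [left|right].
Qed.

Definition spec_act (g : G) (P : spec U) : spec U := Spec (act_ideal_prime g P).

Definition spec_orbit (P : spec U) : set (spec U) :=
  range (fun g => spec_act g P).

Definition GSpec : set (gideal A) :=
  [set I : gideal A | I <> setT :> set U /\
    forall J K : gideal A, ideal_mul J K `<=` I -> J `<=` I \/ K `<=` I].

Definition stratum (I : gideal A) : set (spec U) :=
  [set P : spec U | \bigcap_(g in [set: G]) (spec_act g P : set U) = I].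

Definition maximal_in_stratum (P : spec U) :=
  exists I : gideal A, [/\ GSpec I, stratum I P &
    forall Q : spec U, stratum I Q -> P `<=` Q -> Q = P].

Definition acc_gsemiprime :=
  forall I : nat -> gideal A,
    (forall n, semiprime_ideal (I n)) -> (forall n, I n `<=` I n.+1) ->
    exists N, forall n, (N <= n)%N -> I n = I N.

End ActionSpec.

Arguments GSpec {G U} A.

Section Algebra.
Variables (k : fieldType) (R : algType k).

(* The copy of the base field inside the ring of quotients of R/I. *)
Definition quot_scalar (I : ideal R) (c : k) : martindale (quot_ring I) :=
  mart_embed (quot_proj I c%:A).

Definition RatSpec : set (spec R) :=
  [set P : spec R | extended_centroid (quot_ring P) = range (quot_scalar P)].

Definition dixmier_moeglin :=
  forall P : spec R, [<-> locally_closed P; primitive_ideal P; RatSpec P].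

Definition central_endomorphism (V : lmodType R^c) (phi : {linear V -> V}) :=
  forall psi : {linear V -> V}, phi \o psi =1 psi \o phi.

Definition nullstellensatz :=
  (forall P : spec R, exists S : set (ideal R),
     (forall I, S I -> primitive_ideal I) /\
     ideal_set P = \bigcap_(I in S) (I : set R)) /\
  (forall V : lmodType R^c, simple_module V ->
     forall phi : {linear V -> V}, central_endomorphism phi <->
       exists c : k, forall v, phi v = (c%:A : R^c) *: v).

Definition GRatSpec (G : groupType) (A : ring_action G R) : set (gideal A) :=
  [set I : gideal A | GSpec A I /\
    extended_centroid (quot_ring I) `&`
      fixed_points (mart_action (quot_action I)) = range (quot_scalar I)].

(* [A] is meant to be k-linear.  Every element of R lies in the span of a
   finite linearly independent family v whose span is G-stable, G acting on it
   through [rho]. *)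
Definition rational_action (G : affine_group k) (A : ring_action G R) :=
  forall r : R, exists (n : nat) (v : 'I_n -> R) (rho : G -> 'M[k]_n),
    [/\ forall c : 'I_n -> k, \sum_(i < n) c i *: v i = 0 -> forall i, c i = 0,
        exists c : 'I_n -> k, r = \sum_(i < n) c i *: v i,
        alg_group_hom_GL rho &
        forall g j, A g (v j) = \sum_(i < n) rho g i j *: v i].

End Algebra.

Arguments RatSpec {k} R.
Arguments GRatSpec {k R G} A.

(* Main.v *)
Require Import Defs.
From HB Require Import structures.
From mathcomp Require Import all_boot all_order all_algebra.
From mathcomp Require Import boolp classical_sets cardinality functions.
From mathcomp Require Import topology_structure.
From mathcomp Require Import mpoly.

(* Write P:G for the intersection of the translates g.P.  Everything rests on one
   geometric fact: for every prime P there is an element x outside P:G such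
   that each rational prime Q containing P:G but not x contains a translate
   g.P.  Indeed, let T be the image of R (x) k[Z] in the functions from an
   irreducible component Z of G to the translates of R/P, a finitely generated
   central extension of R modulo an ideal.  Generic lying over (a Groebner basis
   argument on leading coefficients) gives QT /\ R = Q for all Q avoiding some x,
   and if no g.P were inside Q, Martindale's shortening trick, which uses that Q
   is rational, together with Hilbert's Nullstellensatz on Z would produce an
   element of (QT /\ R) \ Q.

   Applied to two rational primes with P:G = Q:G this shows that they lie in
   one orbit.  Applied to the kernel of R[X] -> C(R/P)R/P, X |-> kappa, for a
   nonscalar kappa in C(R/P), it shows that a prime P which is maximal with
   P:G = I, where I is G-rational, is itself rational: otherwise P could be
   enlarged to P + (b - c a), kappa a = b, for a generic scalar c.  With these two
   facts and the Nullstellensatz of R the equivalences become formal. *)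

Set Implicit Arguments.
Unset Strict Implicit.
Unset Printing Implicit Defensive.

Import GRing.Theory Order.TTheory.
(* ring_quotient also exports names such as idealMr. *)
Import Defs.

Local Open Scope classical_set_scope.
Local Open Scope ring_scope.

(** * Dickson's lemma and irreducible components *)

(** [R] satisfies no finiteness condition, so finiteness has to come from elsewhere. The coordinates
    of [G] give one source: relations over [R] among monomials in them are governed by finitely many
    exponents (Dickson's lemma), which is why a single [x] suffices in the geometric fact. Local
    finiteness of the action gives the other: the core of the union of a chain of ideals is the
    union of the cores, so Zorn's lemma applies to the ideals with core inside [I], and [g.P] inside
    [P] forces equality. Extended centroids enter only through pairs of elements: rationality says
    that a pair satisfying the cross relations obeys [b = c a], and in this form the same argument
    serves [R] and [R[X]]. [G] need not be connected, hence the detour through irreducible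
    components: only over these is the intersection of the translates of a prime known to be
    prime. *)

Lemma nondecreasing_subseq (f : nat -> nat) :
  exists phi : nat -> nat, (forall n, phi n < phi n.+1)%N /\
    forall n, (f (phi n) <= f (phi n.+1))%N.
Proof.
have argmin N : exists j, (N < j)%N /\ forall i, (N < i)%N -> (f j <= f i)%N.
  have exv : exists v, `[< exists2 j, (N < j)%N & f j = v >].
    by exists (f N.+1); apply/asboolP; exists N.+1.
  case: (ex_minnP exv) => v /asboolP[j Nj <-] vmin; exists j; split=> // i Ni.
  by apply: vmin; apply/asboolP; exists i.
have [g gP] := choice argmin; exists (fun n => iter n.+1 g 0%N).
split=> n /=; first exact: (gP _).1.
apply: (gP (iter n g 0%N)).2; apply: ltn_trans (gP (g (iter n g 0%N))).1.
exact: (gP _).1.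
Qed.

Lemma strictly_increasing (phi : nat -> nat) :
  (forall n, phi n < phi n.+1)%N ->
  forall a b, (a < b)%N -> (phi a < phi b)%N.
Proof. exact: (@homo_ltn _ phi (fun x y => x < y)%N ltn_trans). Qed.

(** The subsequence is refined one coordinate at a time; after [m] refinements every coordinate is
    nondecreasing along it, and its first two terms form the pair. *)
Lemma mnm_good_pair m (f : nat -> 'X_{1..m}) :
  exists a b, (a < b)%N /\ (f a <= f b)%MM.
Proof.
have mono_upto k : (k <= m)%N -> exists phi : nat -> nat,
    (forall n, phi n < phi n.+1)%N /\
    forall i : 'I_m, (i < k)%N -> forall n, (f (phi n) i <= f (phi n.+1) i)%N.
  elim: k => [|k IHk] ltkm; first by exists id; split.
  have [phi [phiS phif]] := IHk (ltnW ltkm).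
  have [psi [psiS psif]] :=
    nondecreasing_subseq (fun n => f (phi n) (Ordinal ltkm)).
  exists (phi \o psi); split=> [n|i].
    exact: (strictly_increasing phiS (psiS n)).
  rewrite ltnS leq_eqVlt => /predU1P[ik|ltik] n /=.
    by have := psif n; have -> : Ordinal ltkm = i by apply: val_inj.
  have mono : {homo (fun n => f (phi n) i) : a b / (a <= b)%N}.
    exact: (@homo_leq _ _ (fun x y => x <= y)%N leqnn leq_trans (phif i ltik)).
  by apply: mono; apply: ltnW.
have [phi [phiS phif]] := mono_upto m (leqnn m).
exists (phi 0%N), (phi 1%N); split=> //.
by apply/mnm_lepP => i; apply: phif.
Qed.

(** If no finite list worked, one could keep appending an element of [S] above none of the earlier
    ones, and such a sequence has no good pair. *)
Lemma dickson m (S : set 'X_{1..m}) :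
  exists l : seq 'X_{1..m}, (forall b, b \in l -> S b) /\
    forall a, S a -> exists2 b, b \in l & (b <= a)%MM.
Proof.
apply: contrapT => noS.
have ext (l : {l : seq 'X_{1..m} | forall b, b \in l -> S b}) :
    exists a, S a /\ forall b, b \in sval l -> ~~ (b <= a)%MM.
  apply: contrapT => nol; apply: noS; exists (sval l); split=> [|a Sa].
    exact: (svalP l).
  apply: contrapT => noa; apply: nol; exists a; split=> // b lb.
  by apply/negP => ba; apply: noa; exists b.
have [next nextP] := choice ext.
have snoc_sub l b : b \in rcons (sval l) (next l) -> S b.
  by rewrite mem_rcons in_cons => /predU1P[->|/(svalP l)//]; case: (nextP l).
pose snoc l : {l : seq 'X_{1..m} | forall b, b \in l -> S b} :=
  exist _ (rcons (sval l) (next l)) (@snoc_sub l).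
have nil_sub (b : 'X_{1..m}) : b \in [::] -> S b by [].
pose l n := iter n snoc (exist _ [::] nil_sub).
have [a [b [ltab leab]]] := mnm_good_pair (next \o l).
suff la : (next \o l) a \in sval (l b).
  by have [_ /(_ _ la)] := nextP (l b); rewrite leab.
elim: b ltab {leab} => // b IHb; rewrite ltnS leq_eqVlt => /predU1P[->|/IHb lb].
  by rewrite /= mem_rcons mem_head.
by rewrite /= mem_rcons in_cons lb orbT.
Qed.

Section Noetherian.
Variables (k : fieldType) (m : nat).
Implicit Types p q : {mpoly k[m]}.

(** Hilbert's basis theorem in the form needed below. Every leading exponent is above one of
    finitely many, which are all realised in a single [I N]; division by elements with these
    exponents brings [I N.+1] into [I N]. *)
Lemma mpoly_ideal_chain (I : nat -> set {mpoly k[m]}) :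
  (forall n, I n 0) -> (forall n p q, I n p -> I n q -> I n (p + q)) ->
  (forall n p q, I n q -> I n (p * q)) ->
  (forall n, I n `<=` I n.+1) ->
  exists n, I n.+1 `<=` I n.
Proof.
move=> I0 ID IM IS.
have mono a b : (a <= b)%N -> I a `<=` I b.
  elim: b => [|b IHb]; first by rewrite leqn0 => /eqP->.
  by rewrite leq_eqVlt => /predU1P[->//|/IHb Iab] p /Iab /IS.
pose S := [set a | exists n p, [/\ I n p, p != 0 & mlead p = a]].
have [l [lS leadl]] := dickson S.
have [N lN] : exists N, forall b, b \in l ->
    exists p, [/\ I N p, p != 0 & mlead p = b].
  elim: l lS {leadl} => [|b l IHl] lS; first by exists 0%N.
  have [|N lN] := IHl; first by move=> c lc; apply: lS; rewrite in_cons lc orbT.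
  have [n [p [Ip p0 pb]]] := lS _ (mem_head b l).
  exists (maxn n N) => c; rewrite in_cons => /predU1P[->|/lN[q [Iq q0 qc]]].
    by exists p; split=> //; apply: mono Ip; apply: leq_maxl.
  by exists q; split=> //; apply: mono Iq; apply: leq_maxr.
exists N; elim/mleadrect => p IHp Ip.
have [->|p0] := eqVneq p 0; first exact: I0.
have [|_ /lN[q [Iq q0 <-]] qp] := leadl (mlead p); first by exists N.+1, p.
set a := mlead p in qp *; set b := mlead q in qp *.
pose r := (mleadc p / mleadc q) *: ('X_[a - b] * q).
have Ir : I N r by rewrite /r -mul_mpolyC; apply: (IM N); apply: (IM N).
have c0 : mleadc p / mleadc q != 0.
  by rewrite mulf_neq0 ?invr_eq0 ?mleadc_eq0.
have ar : mlead r = a.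
  rewrite mleadZ // mleadM //; first by rewrite (mleadXm k) submK.
  by rewrite -mleadc_eq0 (mleadXm k) mcoeffX eqxx oner_eq0.
rewrite -[p](subrK r); apply: (ID N) => //.
have [->|pr0] := eqVneq (p - r) 0; first exact: I0.
apply: IHp; last first.
  apply: (ID N.+1) => //.
  by rewrite -mulN1r; apply: (IM N.+1); apply: IS.
have := mleadB_le p r; rewrite ar joinxx le_eqVlt => /predU1P[pra|//].
have := mlead_supp pr0; rewrite pra mcoeff_msupp mcoeffB.
suff -> : r@_a = p@_a by rewrite subrr eqxx.
have -> : r@_a = mleadc p / mleadc q * ('X_[a - b] * q)@_(a - b + b).
  by rewrite submK // mcoeffZ.
have := mleadcM ('X_[a - b] : {mpoly k[m]}) q; rewrite (mleadXm k) => ->.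
by rewrite mcoeffX eqxx mul1r divfK // mleadc_eq0.
Qed.

Variables (X : Type) (coord : X -> 'I_m -> k).
Implicit Types Y Z : set X.

Definition vanishing Y : set {mpoly k[m]} :=
  [set p | forall y, Y y -> p.@[coord y] = 0].

Definition alg_closed Y :=
  forall x, (forall p, vanishing Y p -> p.@[coord x] = 0) -> Y x.

Definition alg_irreducible Z :=
  (exists z, Z z) /\
  forall p q, vanishing Z (p * q) -> vanishing Z p \/ vanishing Z q.

Lemma vanishingS Y Z : Y `<=` Z -> vanishing Z `<=` vanishing Y.
Proof. by move=> YZ p Zp y /YZ; apply: Zp. Qed.

(** Noetherian induction: a closed set without a decomposition splits into two closed parts, one of
    which has none either, and iterating gives a chain of vanishing ideals that never stalls. *)
Lemma alg_closed_decomposition Y : alg_closed Y ->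
  exists n (Z : nat -> set X),
    [/\ forall i, (i < n)%N -> alg_irreducible (Z i),
        forall i, (i < n)%N -> alg_closed (Z i) &
        forall x, Y x <-> exists2 i, (i < n)%N & Z i x].
Proof.
pose good Y := exists n (Z : nat -> set X),
    [/\ forall i, (i < n)%N -> alg_irreducible (Z i),
        forall i, (i < n)%N -> alg_closed (Z i) &
        forall x, Y x <-> exists2 i, (i < n)%N & Z i x].
have goodU Y1 Y2 : good Y1 -> good Y2 -> good (Y1 `|` Y2).
  move=> [n1 [Z1 [irr1 cl1 Y1E]]] [n2 [Z2 [irr2 cl2 Y2E]]].
  exists (n1 + n2)%N, (fun i => if (i < n1)%N then Z1 i else Z2 (i - n1)%N).
  split=> [i ltin|i ltin|x].
  - case: ltnP => [/irr1//|lein]; apply: irr2.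
    by rewrite -(ltn_add2l n1) subnKC.
  - case: ltnP => [/cl1//|lein]; apply: cl2.
    by rewrite -(ltn_add2l n1) subnKC.
  split=> [[/Y1E[i ltin Zi]|/Y2E[i ltin Zi]]|[i ltin]].
  - by exists i; rewrite ?ltin // ltn_addr.
  - exists (n1 + i)%N; first by rewrite ltn_add2l.
    by rewrite ltnNge leq_addr addKn.
  case: ltnP => [lti Zi|lein Zi]; first by left; apply/Y1E; exists i.
  by right; apply/Y2E; exists (i - n1)%N => //; rewrite -(ltn_add2l n1) subnKC.
pose bad Y := alg_closed Y /\ ~ good Y.
have step (B : {B | bad B}) : exists B' : {B | bad B},
    sval B' `<=` sval B /\
    exists p, vanishing (sval B') p /\ ~ vanishing (sval B) p.
  case: B => B [clB ngB] /=.
  have [ne|e] := pselect (exists z, B z); last first.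
    case: ngB; exists 0%N, (fun=> set0); split=> // x; split=> [Bx|[]//].
    by case: e; exists x.
  have [p [q [Bpq Bp Bq]]] : exists p q,
      [/\ vanishing B (p * q), ~ vanishing B p & ~ vanishing B q].
    apply: contrapT => npq; apply: ngB; exists 1%N, (fun=> B).
    split=> // [i _|x]; last by split=> [Bx|[]//]; exists 0%N.
    split=> // p q Bpq; apply: contrapT => /not_orP[Bp Bq].
    by apply: npq; exists p, q.
  pose part r := B `&` [set x | r.@[coord x] = 0].
  have clpart r : alg_closed (part r).
    move=> x xr; split; last by apply: xr => y [].
    by apply: clB => s Bs; apply: xr => y [/Bs].
  have BE : B = part p `|` part q.
    apply/seteqP; split=> [x Bx|x [] []//].
    have /eqP := Bpq x Bx; rewrite mevalM mulf_eq0 => /orP[] /eqP x0.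
      by left.
    by right.
  have [gp|ngp] := pselect (good (part p)); last first.
    exists (exist _ (part p) (conj (clpart p) ngp)); split=> [x []//|].
    by exists p; split=> // x [].
  have [gq|ngq] := pselect (good (part q)); last first.
    exists (exist _ (part q) (conj (clpart q) ngq)); split=> [x []//|].
    by exists q; split=> // x [].
  by case: ngB; rewrite BE; apply: goodU.
move=> clY; apply: contrapT => ngY.
have [next nextP] := choice step.
pose B n := iter n next (exist _ Y (conj clY ngY)).
have [n InS] : exists n, vanishing (sval (B n.+1)) `<=` vanishing (sval (B n)).
  apply: (@mpoly_ideal_chain (fun n => vanishing (sval (B n)))).
  - by move=> n y _; rewrite meval0.
  - by move=> n p q Ip Iq y By; rewrite mevalD Ip // Iq // addr0.
  - by move=> n p q Iq y By; rewrite mevalM Iq // mulr0.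
  - by move=> n; apply: vanishingS; apply: (nextP (B n)).1.
by have [_ [p [/InS Bp []]]] := nextP (B n).
Qed.

End Noetherian.

(** * Generic lying over *)

Section PrimeIdeals.
Variable U : pzRingType.
Implicit Types I J P : ideal U.

Definition colon_left P (S : set U) : ideal U.
Proof.
refine (@Ideal U [set u | forall x s, S s -> P (u * x * s)] _ _ _ _).
- by move=> x s _; rewrite !mul0r; apply: ideal0.
- by move=> u v Iu Iv x s Ss; rewrite !mulrDl; apply: idealD; auto.
- by move=> v u Iu x s Ss; rewrite -!mulrA; apply: idealMl; rewrite mulrA; auto.
- by move=> u v Iu x s Ss; rewrite -(mulrA u); auto.
Defined.

Definition colon_right P (S : set U) : ideal U.
Proof.
refine (@Ideal U [set u | forall x s, S s -> P (s * x * u)] _ _ _ _).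
- by move=> x s _; rewrite !mulr0; apply: ideal0.
- by move=> u v Iu Iv x s Ss; rewrite !mulrDr; apply: idealD; auto.
- by move=> v u Iu x s Ss; rewrite mulrA -(mulrA s); auto.
- by move=> u v Iu x s Ss; rewrite mulrA; apply: idealMr; auto.
Defined.

(** Colon ideals stand in for principal ideals: [a] is in [I] by hypothesis, [b] is in
    [colon_right P I] by the choice of [I], and the product of the two lies in [P] at once. *)
Lemma prime_idealM P a b :
  prime_ideal P -> (forall x, P (a * x * b)) -> P a \/ P b.
Proof.
move=> [_ Pprime] Pab; pose I := colon_left P [set b].
have [|IP|JP] := Pprime I (colon_right P I).
- by apply: ideal_mul_sub => u v Iu Jv; rewrite -(mulr1 u); apply: Jv.
- by left; apply: IP => x _ ->.
- by right; apply: JP => x u Iu; apply: Iu.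
Qed.

Lemma prime_idealW P : ~ P 1 ->
  (forall a b, (forall x, P (a * x * b)) -> P a \/ P b) -> prime_ideal P.
Proof.
move=> P1 Pab; split=> [PT|I J IJP]; first by apply: P1; rewrite PT.
apply: contrapT => /not_orP[/existsNP[a /not_implyP[Ia Pa]]].
move=> /existsNP[b /not_implyP[Jb Pb]].
have [x||] // := Pab a b.
by apply: IJP; apply: ideal_mulW => //; apply: idealMr.
Qed.

Lemma prime_ideal1 P : prime_ideal P -> ~ P 1.
Proof.
move=> [PT _] P1; apply: PT; apply/seteqP; split=> // x _.
by rewrite -[x]mulr1; apply: idealMl.
Qed.

Lemma prime_ideal_finite_cap P (S : eqType) (l : seq S) (I : S -> ideal U) :
  prime_ideal P -> (forall s, s \in l -> exists x, I s x /\ ~ P x) ->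
  exists x, (forall s, s \in l -> I s x) /\ ~ P x.
Proof.
move=> Pprime; elim: l => [|s l IHl] lP.
  by exists 1; split=> //; apply: prime_ideal1.
have [|x [lx Px]] := IHl.
  by move=> t tl; apply: lP; rewrite in_cons tl orbT.
have [y [Iy Py]] := lP s (mem_head s l).
have [z Pxzy] : exists z, ~ P (x * z * y).
  by apply/existsNP => /(prime_idealM Pprime) [].
exists (x * z * y); split=> // t; rewrite in_cons => /predU1P[->|tl].
  exact: idealMl.
by rewrite -mulrA; apply: idealMr; apply: lx.
Qed.

End PrimeIdeals.

Definition ideal_preim (U V : pzRingType) (f : {rmorphism U -> V})
  (I : ideal V) : ideal U.
Proof.
refine (@Ideal U [set x | I (f x)] _ _ _ _) => /=.
- by rewrite rmorph0; apply: ideal0.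
- by move=> x y Ix Iy; rewrite rmorphD; apply: idealD.
- by move=> u x Ix; rewrite rmorphM; apply: idealMl.
- by move=> x u Ix; rewrite rmorphM; apply: idealMr.
Defined.

Section GenericLyingOver.
Variables (B T : pzRingType) (K : ideal T) (phi : {rmorphism B -> T}).
Variables (m : nat) (mon : 'X_{1..m} -> T).
Hypothesis mon0 : mon 0%MM = 1.
Hypothesis monD : forall a b, mon (a + b)%MM = mon a * mon b.
Hypothesis monC : forall a x, mon a * x = x * mon a.
Implicit Types (Q : ideal B) (a b c : 'X_{1..m}) (t : T).

(** Exponents may repeat and come in any order; [lower_lead] collects the terms of largest
    exponent. *)
Inductive lower Q (D : set 'X_{1..m}) : T -> Prop :=
| lower0 : lower Q D 0
| lowerS c q t of D c & Q q & lower Q D t : lower Q D (phi q * mon c + t).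

Definition below b : set 'X_{1..m} := [set c | (c < b)%O].

Lemma lowerD Q D t1 t2 : lower Q D t1 -> lower Q D t2 -> lower Q D (t1 + t2).
Proof.
elim=> [|c q t Dc Qq _ IHt] Dt2; first by rewrite add0r.
by rewrite -addrA; apply: lowerS => //; apply: IHt.
Qed.

Lemma lower1 Q (D : set 'X_{1..m}) c q :
  D c -> Q q -> lower Q D (phi q * mon c).
Proof.
by move=> Dc Qq; rewrite -[_ * _]addr0; apply: lowerS => //; apply: lower0.
Qed.

Lemma lowerW Q1 Q2 D1 D2 t :
  Q1 `<=` Q2 -> D1 `<=` D2 -> lower Q1 D1 t -> lower Q2 D2 t.
Proof.
move=> Q12 D12; elim=> [|c q {}t Dc Qq _ IHt]; first exact: lower0.
by apply: lowerS => //; [apply: D12 | apply: Q12].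
Qed.

Lemma lowerMl Q D x t : lower Q D t -> lower Q D (phi x * t).
Proof.
elim=> [|c q {}t Dc Qq _ IHt]; first by rewrite mulr0; apply: lower0.
by rewrite mulrDr mulrA -rmorphM; apply: lowerS => //; apply: idealMl.
Qed.

Lemma lowerMr Q D x t : lower Q D t -> lower Q D (t * phi x).
Proof.
elim=> [|c q {}t Dc Qq _ IHt]; first by rewrite mul0r; apply: lower0.
rewrite mulrDl -mulrA monC mulrA -rmorphM.
by apply: lowerS => //; apply: idealMr.
Qed.

Lemma lowerN Q D t : lower Q D t -> lower Q D (- t).
Proof. by move=> /(lowerMl (- 1)); rewrite rmorphN1 mulN1r. Qed.

Lemma lowerMmon Q b c t :
  lower Q (below b) t -> lower Q (below (b + c)%MM) (t * mon c).
Proof.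
elim=> [|d q {}t ltdb Qq _ IHt]; first by rewrite mul0r; apply: lower0.
rewrite mulrDl -mulrA -monD; apply: lowerS => //.
by rewrite /below /= ltmc_add2l.
Qed.

Lemma lowerMQ Q D q t : Q q -> lower (idealT B) D t -> lower Q D (phi q * t).
Proof.
move=> Qq; elim=> [|c u {}t Dc _ _ IHt]; first by rewrite mulr0; apply: lower0.
by rewrite mulrDr mulrA -rmorphM; apply: lowerS => //; apply: idealMr.
Qed.

Lemma lower_lead Q (D : set 'X_{1..m}) t : lower Q D t -> t = 0 \/
  exists c q s, [/\ D c, Q q, lower Q (below c) s & t = phi q * mon c + s].
Proof.
elim=> [|c q {}t Dc Qq _ IHt]; first by left.
right; case: IHt => [->|[d [u [s [Dd Qu ds ->]]]]].
  by exists c, q, 0; split=> //; apply: lower0.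
case: (ltgtP c d) => [ltcd|ltdc|eqcd].
- exists d, u, (phi q * mon c + s); split=> //; first exact: lowerS.
  by rewrite addrCA.
- exists c, q, (phi u * mon d + s); split=> //; apply: lowerS => //.
  by apply: lowerW ds => // e ltec; apply: lt_trans ltdc.
- exists d, (q + u), s; split=> //; first exact: idealD.
  by rewrite eqcd rmorphD mulrDl addrA.
Qed.

(* The leading coefficients in degree b of the relations modulo K. *)
Definition lead_ideal b : ideal B.
Proof.
refine (@Ideal B [set u | exists t, lower (idealT B) (below b) t /\
  K (phi u * mon b - t)] _ _ _ _).
- exists 0; split; first exact: lower0.
  by rewrite rmorph0 mul0r subr0; apply: ideal0.
- move=> u v [s [bs Ks]] [t [bt Kt]]; exists (s + t).
  split; first exact: lowerD.
  by rewrite rmorphD mulrDl opprD addrACA; apply: idealD.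
- move=> v u [t [bt Kt]]; exists (phi v * t); split; first exact: lowerMl.
  by rewrite rmorphM -mulrA -mulrBr; apply: idealMl.
- move=> u v [t [bt Kt]]; exists (t * phi v); split; first exact: lowerMr.
  by rewrite rmorphM -mulrA -monC mulrA -mulrBl; apply: idealMr.
Defined.

Lemma lead_idealS a b : (a <= b)%MM -> lead_ideal a `<=` lead_ideal b.
Proof.
move=> ab u [t [ut Kt]]; exists (t * mon (b - a)%MM).
rewrite -[X in below X](submK ab) addmC; split; first exact: lowerMmon.
by rewrite -[X in mon X](submK ab) addmC monD mulrA -mulrBl; apply: idealMr.
Qed.

Let J := ideal_preim phi K.

(* After multiplication by suitable elements outside Q a relation modulo K is
   reduced to its normal form, from which r can be read off. *)
Lemma generic_lying_over : prime_ideal J ->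
  exists x, ~ J x /\ forall Q, prime_ideal Q -> J `<=` Q -> ~ Q x ->
    forall r t, lower Q setT t -> K (phi r - t) -> Q r.
Proof.
move=> Jprime.
(* Only exponents whose leading coefficients are not all in [J] are an obstacle. As [lead_ideal]
   grows with the exponent, an [x] that is a leading coefficient at the finitely many exponents of
   [l] is one at all of them. *)
have [l [lS lmin]] := dickson [set b | ~ (lead_ideal b `<=` J)].
have [|x [lx Jx]] := @prime_ideal_finite_cap B J _ l lead_ideal Jprime.
  by move=> b /lS /existsNP[y /not_implyP[? ?]]; exists y.
exists x; split=> // Q Qprime JQ Qx.
have step (D : set 'X_{1..m}) :
    (forall c, D c ->
       forall r t, lower Q (below c) t -> K (phi r - t) -> Q r) ->
    forall r t, lower Q D t -> K (phi r - t) -> Q r.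
  move=> IH r t Dt Kt.
  have [t0|[c [q [s [Dc Qq cs tE]]]]] := lower_lead Dt.
    by apply: JQ; rewrite /J /= -[phi r]subr0 -t0.
  have [cJ|/lmin[d /lx Adx /lead_idealS dc]] := pselect (lead_ideal c `<=` J).
    have [c0|c_neq0] := eqVneq c 0%MM.
      have s0 : s = 0.
        have [//|[e [_ [_ [+ _ _ _]]]]] := lower_lead cs.
        by rewrite c0 /below /= ltNge le0x.
      rewrite -[r](subrK q); apply: idealD => //; apply: JQ.
      by rewrite /J /= rmorphB; move: Kt; rewrite tE s0 addr0 c0 mon0 mulr1.
    have /cJ Kq : lead_ideal c q.
      exists (phi r * mon 0%MM - s); split.
        apply: lowerD; first by apply: lower1; rewrite // /below /= lt0x.
        by apply: lowerN; apply: lowerW cs.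
      rewrite mon0 mulr1 opprB addrA -tE -opprB.
      exact: idealN.
    apply: (IH c Dc _ s) => //.
    have -> : phi r - s = (phi r - t) + phi q * mon c.
      by rewrite tE opprD addrA addrAC subrK.
    by apply: idealD => //; apply: idealMr.
  (* Here [x] is a leading coefficient at [c]. Multiplied by [phi (y * x)], the relation has top
     term [phi (q * y) * (phi x * mon c)], which [u] replaces by lower terms; it is now a relation
     for [r * y * x]. *)
  apply: contrapT => Qr.
  have [y Qryx] : exists y, ~ Q (r * y * x).
    by apply/existsNP => /(prime_idealM Qprime) [].
  have [u [cu Ku]] : lead_ideal c x by apply: dc.
  apply: Qryx; apply: (IH c Dc _ (s * phi (y * x) + phi (q * y) * u)).
    apply: lowerD; first exact: lowerMr.
    by apply: lowerMQ => //; apply: idealMr.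
  have -> : phi (r * y * x) - (s * phi (y * x) + phi (q * y) * u) =
      (phi r - t) * phi (y * x) + phi (q * y) * (phi x * mon c - u).
    have E : phi q * mon c * phi (y * x) = phi (q * y) * (phi x * mon c).
      by rewrite -mulrA monC !rmorphM !mulrA.
    rewrite tE mulrBl mulrDl E mulrBr -mulrA rmorphM.
    by rewrite [_ + s * _]addrC !opprD !addrA subrK.
  by apply: idealD; [apply: idealMr | apply: idealMl].
(* The set of all exponents has no largest element, so [step] is used once more on top of the
   well-founded induction on [b]. *)
apply: (step setT) => c _; move: c; apply: ltmwf => b IHb.
exact: (step (below b)).
Qed.

End GenericLyingOver.

(** * Hilbert's Nullstellensatz *)

Lemma ideal_zorn (U : pzRingType) (F : ideal U -> Prop) (I0 : ideal U) :
  F I0 ->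
  (forall (C : set (ideal U)) (V : ideal U),
     C !=set0 -> (forall I, C I -> F I) ->
     (forall I J, C I -> C J -> I `<=` J \/ J `<=` I) ->
     (forall x, V x <-> exists2 I, C I & I x) -> F V) ->
  exists M : ideal U, [/\ F M, I0 `<=` M &
    forall J : ideal U, M `<=` J -> F J -> J `<=` M].
Proof.
move=> FI0 Fchain.
pose S := {I : ideal U | F I /\ I0 `<=` I}.
pose leS (I J : S) := `[< sval I `<=` sval J >].
have [||||M Mmax] := @Zorn S leS.
- by move=> I; apply/asboolP.
- by move=> I J K /asboolP IJ /asboolP JK; apply/asboolP => x /IJ /JK.
- move=> [I FI] [J FJ] /asboolP /= IJ /asboolP /= JI.
  have E : I = J by apply: ideal_eq; apply/seteqP.
  by subst J; congr exist; apply: Prop_irrelevance.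
- move=> A Atot; have [[I AI]|A0] := pselect (A !=set0); last first.
    exists (exist _ I0 (conj FI0 (@subset_refl _ I0))) => J AJ.
    by case: A0; exists J.
  have VP : exists V : ideal U, forall x, V x <-> exists2 J, A J & sval J x.
    unshelve eexists.
      refine (@Ideal U [set x | exists2 J, A J & sval J x] _ _ _ _).
      + by exists I => //; apply: ideal0.
      + move=> x y [J AJ Jx] [K AK Ky].
        have [/asboolP JK|/asboolP KJ] := Atot J K AJ AK.
          by exists K => //; apply: idealD => //; apply: JK.
        by exists J => //; apply: idealD => //; apply: KJ.
      + by move=> u x [J AJ Jx]; exists J => //; apply: idealMl.
      + by move=> x u [J AJ Jx]; exists J => //; apply: idealMr.
    by [].
  have [V VE] := VP.
  have FV : F V.
    apply: (Fchain [set J | exists2 K, A K & J = sval K]).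
    + by exists (sval I), I.
    + by move=> _ [K AK ->]; case: (svalP K).
    + move=> _ _ [K AK ->] [L AL ->].
      by have [/asboolP|/asboolP] := Atot K L AK AL; [left|right].
    + move=> x; split=> [/VE[J AJ Jx]|[_ [J AJ ->] Jx]].
        by exists (sval J) => //; exists J.
      by apply/VE; exists J.
  have I0V : I0 `<=` V.
    by move=> x I0x; apply/VE; exists I => //; apply: (svalP I).2.
  exists (exist _ V (conj FV I0V)) => J AJ; apply/asboolP => x Jx /=.
  by apply/VE; exists J.
exists (sval M); split; [exact: (svalP M).1|exact: (svalP M).2|].
move=> J MJ FJ.
have I0J : I0 `<=` J by move=> x /(svalP M).2 /MJ.
have := Mmax (exist _ J (conj FJ I0J)) => /(_ _) E.
by rewrite -E //; apply/asboolP.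
Qed.

Definition zero_ideal (U : pzRingType) : ideal U.
Proof.
refine (@Ideal U [set 0] _ _ _ _) => //=.
- by move=> x y -> ->; rewrite addr0.
- by move=> u x ->; rewrite mulr0.
- by move=> x u ->; rewrite mul0r.
Defined.

Definition ideal_add (U : pzRingType) (I J : ideal U) : ideal U.
Proof.
refine (@Ideal U [set x | exists y z, [/\ I y, J z & x = y + z]] _ _ _ _).
- by exists 0, 0; rewrite addr0; split=> //; apply: ideal0.
- move=> _ _ [y [z [Iy Jz ->]]] [y' [z' [Iy' Jz' ->]]].
  by exists (y + y'), (z + z'); rewrite addrACA; split=> //; apply: idealD.
- move=> u _ [y [z [Iy Jz ->]]]; exists (u * y), (u * z).
  by rewrite mulrDr; split=> //; apply: idealMl.
- move=> _ u [y [z [Iy Jz ->]]]; exists (y * u), (z * u).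
  by rewrite mulrDl; split=> //; apply: idealMr.
Defined.

Definition ideal_adjoin (U : comPzRingType) (M : ideal U) (x : U) : ideal U.
Proof.
refine (@Ideal U [set z | exists y, M (z - x * y)] _ _ _ _).
- by exists 0; rewrite mulr0 subr0; apply: ideal0.
- move=> z1 z2 [y1 M1] [y2 M2]; exists (y1 + y2).
  by rewrite mulrDr opprD addrACA; apply: idealD.
- move=> u z [y My]; exists (u * y).
  by rewrite mulrCA -mulrBr; apply: idealMl.
- move=> z u [y My]; exists (y * u).
  by rewrite mulrA -mulrBl; apply: idealMr.
Defined.

(** At a root [c] of [p * 'X + 1] one has [p.[c] * c = -1], so [p] does not vanish there. *)
Lemma closed_field_nonroot (k : closedFieldType) (p : {poly k}) :
  p != 0 -> exists c, p.[c] != 0.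
Proof.
move=> p0; have sz : size (p * 'X + 1%:P) != 1%N.
  by rewrite size_MXaddC (negPf p0) /= eqSS size_poly_eq0.
have [c /rootP] := elimT (closed_rootP _) sz.
rewrite !hornerE => pc; exists c; apply: contra_eq_neq pc => ->.
by rewrite mul0r add0r oner_eq0.
Qed.

(** Modulo a maximal ideal [M] over [I] every variable is a scalar, and evaluation at these scalars
    is reduction modulo [M]. Generic lying over, for one variable inside the polynomial ring, takes
    the place of Zariski's lemma. *)
Lemma weak_nullstellensatz (k : closedFieldType) m (I : ideal {mpoly k[m]}) :
  ~ I 1 -> exists c : 'I_m -> k, forall p, I p -> p.@[c] = 0.
Proof.
move=> I1.
have [|M [M1 IM Mmax]] := @ideal_zorn _ (fun J => ~ J 1) I I1.
  move=> C V _ C1 _ VE /VE [J CJ J1].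
  exact: C1 CJ J1.
have Minv x : ~ M x -> exists y, M (1 - x * y).
  move=> Mx; apply: contrapT => noy; apply: Mx.
  apply: (Mmax (ideal_adjoin M x)).
  - by move=> z Mz; exists 0; rewrite mulr0 subr0.
  - by [].
  - by exists 1; rewrite mulr1 subrr; apply: ideal0.
have MM x y : M (x * y) -> ~ M x -> M y.
  move=> Mxy /Minv[z Mz].
  have -> : y = (1 - x * z) * y + z * (x * y).
    by rewrite mulrBl mul1r mulrCA mulrA subrK.
  by apply: idealD; [apply: idealMr | apply: idealMl].
have MC a : a != 0 -> ~ M a%:MP.
  move=> a0 Ma; apply: M1; rewrite -(mpolyC1 m k) -(mulVf a0) mpolyCM.
  exact: idealMl.
suff rootM i : exists c, M ('X_i - c%:MP).
  have [c cM] := choice rootM; exists c => p /IM Mp.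
  have Mpc : M (p - (p.@[c])%:MP).
    pose E q := M (q - (q.@[c])%:MP); rewrite -/(E p).
    have EM q1 q2 : E q1 -> E q2 -> E (q1 * q2).
      rewrite /E => M1' M2'; rewrite mevalM mpolyCM.
      have -> : q1 * q2 - (q1.@[c])%:MP * (q2.@[c])%:MP =
          q1 * (q2 - (q2.@[c])%:MP) + (q1 - (q1.@[c])%:MP) * (q2.@[c])%:MP.
        by rewrite mulrBr mulrBl addrA subrK.
      by apply: idealD; [apply: idealMl | apply: idealMr].
    have EC a : E a%:MP by rewrite /E mevalC subrr; apply: ideal0.
    elim/mpolyind: p {Mp} => [|a n p _ _ Ep]; first exact: (EC 0).
    rewrite /E mevalD mpolyCD opprD addrACA; apply: idealD => //.
    rewrite -/(E _) -mul_mpolyC; apply: (EM _ _) => //.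
    rewrite mpolyXE_id; elim/big_rec: _ => [|j q _ Eq]; first exact: (EC 1).
    apply: (EM _ _) => //; elim: (n j) => [|l IHl]; first exact: (EC 1).
    by rewrite exprS; apply: (EM _ _) => //; rewrite /E mevalXU; apply: cM.
  have : M (p.@[c])%:MP.
    by rewrite -[X in M X](subKr p); apply: idealB.
  by apply: contraPeq => /MC.
apply: contrapT => noc.
pose phi : {rmorphism {poly k} -> {mpoly k[m]}} := horner_alg 'X_i.
have phiX z : phi ('X - z%:P) = 'X_i - z%:MP.
  by rewrite rmorphB /= horner_algX horner_algC alg_mpolyC.
have phiC a : phi a%:P = a%:MP by rewrite /= horner_algC alg_mpolyC.
have J0 p : ideal_preim phi M p -> p = 0.
  have prod_notin s : ~ M (phi (\prod_(z <- s) ('X - z%:P))).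
    elim: s => [|z s IHs]; first by rewrite big_nil rmorph1.
    rewrite big_cons rmorphM phiX => /MM Ms; apply: IHs; apply: Ms => Mz.
    by apply: noc; exists z.
  apply: contraPeq => p0; have [s ->] := closed_field_poly_normal p.
  rewrite -mul_polyC /ideal_preim /mkset /= rmorphM => /MM Ms.
  apply: (prod_notin s); apply: Ms.
  by rewrite phiC; apply: MC; rewrite lead_coef_eq0.
have preim0 : ideal_preim phi M 0 by apply: ideal0.
have Jprime : prime_ideal (ideal_preim phi M).
  apply: prime_idealW => [/J0/eqP|a b Jab]; first by rewrite oner_eq0.
  have /J0/eqP := Jab 1; rewrite mulr1 mulf_eq0.
  by move=> /orP[] /eqP ->; [left|right].
(* Were 'X_i transcendental modulo M, generic lying over would keep the generic
   'X - z from becoming invertible modulo M. *)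
have [|||x [Jx xP]] :=
    @generic_lying_over _ _ M phi m (fun a => 'X_[a]) _ _ _ Jprime.
- exact: mpolyX0.
- by move=> a b; rewrite mpolyXD.
- by move=> a x; rewrite mulrC.
have [|z xz] := @closed_field_nonroot k x.
  by apply/eqP => x0; apply: Jx; rewrite x0.
pose Q := ideal_preim (horner_eval z) (zero_ideal k).
have QE p : Q p <-> p.[z] = 0 by [].
have Qprime : prime_ideal Q.
  apply: prime_idealW => [/QE/eqP|a b Qab]; first by rewrite hornerC oner_eq0.
  have /QE/eqP := Qab 1; rewrite mulr1 hornerM mulf_eq0.
  by move=> /orP[] /eqP /QE; [left|right].
have [y My] : exists y, M (1 - ('X_i - z%:MP) * y).
  by apply: Minv => Mz; apply: noc; exists z.
have /QE : Q 1.
  apply: (xP Q Qprime _ _ 1 (('X_i - z%:MP) * y)).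
  - by move=> p /J0 ->; apply: ideal0.
  - by move=> /QE/eqP; rewrite (negPf xz).
  - rewrite -phiX; apply: lowerMQ; first by apply/QE; rewrite !hornerE subrr.
    rewrite [y]mpolyE; elim/big_rec: _ => [|a t _ yt]; first exact: lower0.
    rewrite -mul_mpolyC -phiC.
    exact: (@lowerS _ _ phi).
  - by rewrite rmorph1.
by rewrite hornerC => /eqP; rewrite oner_eq0.
Qed.

(** * Rational primes over the generic point of an orbit *)

Lemma subspace_row_space (k : fieldType) n (S : set 'rV[k]_n) :
  S 0 -> (forall u v, S u -> S v -> S (u + v)) ->
  (forall c u, S u -> S (c *: u)) ->
  exists M : 'M[k]_n, forall u, S u <-> (u <= M)%MS.
Proof.
move=> S0 SD SZ.
have Ssub (M : 'M[k]_n) u : (forall i, S (row i M)) -> (u <= M)%MS -> S u.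
  move=> SM /submxP[D ->]; rewrite mulmx_sum_row.
  by apply: (big_ind S) => // i _; apply: SZ.
pose good r :=
  `[< exists M : 'M[k]_n, (forall i, S (row i M)) /\ \rank M = r >].
have exgood : exists r, good r.
  exists 0%N; apply/asboolP; exists 0; split=> [i|]; last exact: mxrank0.
  by rewrite row0.
have ub r : good r -> (r <= n)%N.
  by move=> /asboolP[M [_ <-]]; apply: rank_leq_row.
case: (ex_maxnP exgood ub) => _ /asboolP[M [SM <-]] Mmax.
exists M => u; split; last exact: Ssub.
move=> Su; apply: contraT => uM.
have /Mmax : good (\rank (M + u)%MS).
  apply/asboolP; exists (M + u)%MS; split=> // i.
  have /sub_addsmxP[[D c] /= ->] := row_sub i (M + u)%MS.
  apply: SD; first by apply: (Ssub M) => //; apply: submxMl.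
  by rewrite [c]mx11_scalar mul_scalar_mx; apply: SZ.
rewrite leqNgt rank_ltmx // ltmxE addsmxSl /=.
by apply: contra uM; apply: submx_trans (addsmxSr _ _).
Qed.

HB.instance Definition _ (X : Type) (B : pzRingType) :=
  GRing.isZmodMorphism.Build B (X -> B) (@cst X B) (fun _ _ => erefl).
HB.instance Definition _ (X : Type) (B : pzRingType) :=
  GRing.isMonoidMorphism.Build B (X -> B) (@cst X B)
    (conj erefl (fun _ _ => erefl)).

Section OrbitClosure.
Variables (k : closedFieldType) (G : affine_group k) (B : pzRingType).
Variables (iota : {rmorphism k -> B}) (A : ring_action G B).
Hypothesis iotaC : forall c b, iota c * b = b * iota c.
Local Notation coord := (@ag_coord k G).
Local Notation d := (ag_dim G).
Hypothesis orbit_regular : forall b, exists n (v : 'I_n -> B)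
  (f : 'I_n -> {mpoly k[d]}),
  forall g, A g b = \sum_(i < n) iota (f i).@[coord g] * v i.
Implicit Types (P Q : ideal B) (Z : set G).

(** For prime [Q] the cross relation says that [a |-> b] defines a central multiplier of [B/Q],
    which has to be a scalar. [B] is a ring with a central image of [k] because both [R] and
    [{poly R}] will be used. *)
Definition rational_at Q := forall a b, ~ Q a ->
  (forall x, Q (a * x * b - b * x * a)) -> exists c, Q (b - iota c * a).

Lemma act_surj g x : exists y, A g y = x.
Proof. by exists (A g^-1%g x); rewrite actVK. Qed.

(** The [A g^-1 a] are combinations of fixed elements with coefficients polynomial in [g], and
    membership of a combination in [P] is a system of linear conditions on its coefficient
    vector. *)
Lemma transporter_closed P a : exists E : set {mpoly k[d]},
  forall g, P (A g^-1%g a) <-> forall p, E p -> p.@[coord g] = 0.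
Proof.
have [n [v [f fE]]] := orbit_regular a.
pose S : set 'rV[k]_n := [set u | P (\sum_i iota (u 0 i) * v i)].
have [|||M MS] := @subspace_row_space k n S.
- rewrite /S /= big1 => [|i _]; first exact: ideal0.
  by rewrite mxE rmorph0 mul0r.
- move=> u w Su Sw; rewrite /S /=.
  under eq_bigr do rewrite mxE rmorphD mulrDl.
  by rewrite big_split; apply: idealD.
- move=> c u Su; rewrite /S /=.
  under eq_bigr do rewrite mxE rmorphM -mulrA.
  by rewrite -mulr_sumr; apply: idealMl.
have [h hE] := choice (@ag_inv k G).
pose H := [tuple h j | j < d].
pose q j := \sum_i (f i \mPo H) * ((cokermx M) i j)%:MP.
exists (range q) => g.
have qE j : (q j).@[coord g] =
    ((\row_i (f i).@[coord g^-1%g]) *m cokermx M) 0 j.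
  rewrite /q raddf_sum mxE; apply: eq_bigr => i _ /=.
  rewrite mevalM mevalC mxE comp_mpoly_meval; congr (_.@[_] * _).
  by apply/funext => l; rewrite tnth_mktuple -hE.
have -> : P (A g^-1%g a) <-> S (\row_i (f i).@[coord g^-1%g]).
  by rewrite /S /= fE; under [in X in _ <-> X]eq_bigr do rewrite mxE.
rewrite MS submxE; split=> [/eqP Mg _ [j _ <-]|qg]; first by rewrite qE Mg mxE.
by apply/eqP/rowP => j; rewrite -qE mxE; apply: qg; exists j.
Qed.

Definition transporter_ideal Z P : ideal B.
Proof.
refine (@Ideal B [set x | forall z, Z z -> P (A z^-1%g x)] _ _ _ _).
- by move=> z _; rewrite rmorph0; apply: ideal0.
- by move=> x y Px Py z Zz; rewrite rmorphD; apply: idealD; auto.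
- by move=> u x Px z Zz; rewrite rmorphM; apply: idealMl; auto.
- by move=> x u Px z Zz; rewrite rmorphM; apply: idealMr; auto.
Defined.

(** If neither [a] nor [b] were in the ideal, the closed sets of [z] with [a] in [z.P], respectively
    [b] in [z.P], would not contain [Z], and yet together they cover the irreducible [Z]. *)
Lemma transporter_ideal_prime Z P : alg_irreducible coord Z ->
  prime_ideal P -> prime_ideal (transporter_ideal Z P).
Proof.
move=> [[z0 Zz0] Zirr] Pprime; apply: prime_idealW => [|a b Jab].
  by move=> /(_ _ Zz0); rewrite rmorph1; apply: prime_ideal1.
apply: contrapT => /not_orP[/existsNP[z1 /not_implyP[Zz1 az1]]].
move=> /existsNP[z2 /not_implyP[Zz2 bz2]].
have [E EP] := transporter_closed P a; have [F FP] := transporter_closed P b.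
have [p [Ep pz1]] : exists p, E p /\ p.@[coord z1] <> 0.
  apply: contrapT => nop; apply/az1/EP => p Ep; apply: contrapT => pz1.
  by apply: nop; exists p.
have [q [Fq qz2]] : exists q, F q /\ q.@[coord z2] <> 0.
  apply: contrapT => noq; apply/bz2/FP => q Fq; apply: contrapT => qz2.
  by apply: noq; exists q.
have [z Zz|pZ|qZ] := Zirr p q; [|exact: pz1 (pZ _ Zz1)|exact: qz2 (qZ _ Zz2)].
have [|/EP pz|/FP qz] := @prime_idealM _ P (A z^-1%g a) (A z^-1%g b) Pprime.
- move=> x; have [y <-] := act_surj z^-1%g x; rewrite -!rmorphM.
  exact: Jab.
- by rewrite mevalM (pz p) // mul0r.
- by rewrite mevalM (qz q) // mulr0.
Qed.

Section Component.
Variables (Z : set G) (P : ideal B).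
Hypothesis Zclosed : alg_closed coord Z.
Hypothesis Zirr : alg_irreducible coord Z.
Hypothesis Pprime : prime_ideal P.

Local Notation T := (G -> B).
Let phi : {rmorphism B -> T} := @cst G B.
Let pf (f : {mpoly k[d]}) : T := fun g => iota f.@[coord g].
Let mon (a : 'X_{1..d}) : T := pf 'X_[a].

(** Modulo this ideal a function is known only through its values at the [z] in [Z], each modulo
    [z.P]. The constants in it form [transporter_ideal Z P]. *)
Definition vanishing_ideal : ideal T.
Proof.
refine (@Ideal T [set F : T | forall z, Z z -> P (A z^-1%g (F z))] _ _ _ _).
- by move=> z _; rewrite rmorph0; apply: ideal0.
- by move=> x y Px Py z Zz; rewrite rmorphD; apply: idealD; auto.
- by move=> u x Px z Zz; rewrite rmorphM; apply: idealMl; auto.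
- by move=> x u Px z Zz; rewrite rmorphM; apply: idealMr; auto.
Defined.
Let K := vanishing_ideal.

Let pfC f t : pf f * t = t * pf f.
Proof. by apply/funext => g; apply: iotaC. Qed.

Let pfM f1 f2 : pf (f1 * f2) = pf f1 * pf f2.
Proof. by apply/funext => g; rewrite /pf mevalM rmorphM. Qed.

Let pfD f1 f2 : pf (f1 + f2) = pf f1 + pf f2.
Proof. by apply/funext => g; rewrite /pf mevalD rmorphD. Qed.

Let pfX c : pf c%:MP = phi (iota c).
Proof. by apply/funext => g; rewrite /pf mevalC. Qed.

Let mon0 : mon 0%MM = 1.
Proof. by apply/funext => g; rewrite /mon /pf mpolyX0 meval1 rmorph1. Qed.

Let monD a b : mon (a + b)%MM = mon a * mon b.
Proof. by rewrite /mon mpolyXD pfM. Qed.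

Let QT Q (F : T) := exists t, lower phi mon Q setT t /\ K (F - t).

Let QTD Q F1 F2 : QT Q F1 -> QT Q F2 -> QT Q (F1 + F2).
Proof.
move=> [t1 [Q1 K1]] [t2 [Q2 K2]]; exists (t1 + t2); split; first exact: lowerD.
by rewrite opprD addrACA; apply: idealD.
Qed.

Let QTl Q x F : QT Q F -> QT Q (phi x * F).
Proof.
move=> [t [Qt Kt]]; exists (phi x * t); split; first exact: lowerMl.
by rewrite -mulrBr; apply: idealMl.
Qed.

Let QTr Q x F : QT Q F -> QT Q (F * phi x).
Proof.
move=> [t [Qt Kt]]; exists (t * phi x); split.
  by apply: lowerMr => // a u; apply: pfC.
by rewrite -mulrBl; apply: idealMr.
Qed.

Let QTK Q F : K F -> QT Q F.
Proof. by move=> KF; exists 0; rewrite subr0; split=> //; apply: lower0. Qed.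

Let QTmon Q a F : QT Q F -> QT Q (mon a * F).
Proof.
move=> [t [Qt Kt]]; exists (mon a * t); split; last first.
  by rewrite -mulrBr; apply: idealMl.
elim: Qt => [|c q {Kt}t _ Qq _ IHt]; first by rewrite mulr0; apply: lower0.
rewrite mulrDr mulrA pfC -mulrA -monD; exact: lowerS.
Qed.

Let QTpf Q f F : QT Q F -> QT Q (pf f * F).
Proof.
move=> QF; elim/mpolyind: f => [|c a f _ _ IHf].
  have -> : pf 0 * F = 0.
    by apply/funext => g; rewrite /pf /= /GRing.mul /= meval0 rmorph0 mul0r.
  by apply: QTK; apply: ideal0.
rewrite pfD mulrDl; apply: QTD => //.
by rewrite -mul_mpolyC pfM pfX -mulrA; apply: QTl; apply: QTmon.
Qed.

Let QTQ Q q : Q q -> QT Q (phi q).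
Proof.
move=> Qq; exists (phi q); split; last by rewrite subrr; apply: ideal0.
by rewrite -[phi q]mulr1 -mon0; apply: lower1.
Qed.

(* A relation of minimal length modulo a rational ideal is, up to scalars,
   supported on a single element. *)
Let shorten Q z n (v : 'I_n -> B) (f : 'I_n -> {mpoly k[d]}) :
  prime_ideal Q -> rational_at Q -> Z z ->
  QT Q (\sum_(i < n) pf (f i) * phi (v i)) ->
  ~ Q (\sum_(i < n) iota (f i).@[coord z] * v i) ->
  exists h u, [/\ ~ Q u, QT Q (pf h * phi u) & h.@[coord z] != 0].
Proof.
move=> Qprime Qrat Zz; elim: n v f => [|n IHn] v f.
  by rewrite [X in ~ Q X -> _]big_ord0 => _ []; apply: ideal0.
set w := \sum_i pf _ * _; set V := \sum_i iota _ * _ => Qw QV.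
(* If some [V x v_j - v_j x V] is outside [Q], then [w x v_j - v_j x w] has lost its [j]-th term, is
   still in [QT Q], and has that value at [z]. *)
have [[j [x Qjx]]|nj] :=
    pselect (exists j x, ~ Q (V * x * v j - v j * x * V)).
  have comm_sum (S : pzRingType) (a : 'I_n.+1 -> S) (psi : {rmorphism B -> S}) :
      (forall i y, a i * y = y * a i) ->
      (\sum_i a i * psi (v i)) * psi (x * v j) +
        psi (- v j * x) * (\sum_i a i * psi (v i)) =
      \sum_i a (lift j i) *
        psi (v (lift j i) * x * v j - v j * x * v (lift j i)).
    move=> aC; rewrite mulr_suml mulr_sumr -big_split /=.
    rewrite (bigD1_ord j) //= [X in X + _](_ : _ = 0) ?add0r.
      apply: eq_bigr => i _; rewrite mulrA -aC -!mulrA -mulrDr -!rmorphM.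
      by rewrite -rmorphD !mulNr !mulrA.
    rewrite mulrA -aC -!mulrA -mulrDr -!rmorphM -rmorphD !mulNr !mulrA.
    by rewrite subrr rmorph0 mulr0.
  apply: (IHn (fun i => v (lift j i) * x * v j - v j * x * v (lift j i))
              (f \o lift j)).
    have := QTD (QTr (x * v j) Qw) (QTl (- v j * x) Qw).
    by rewrite /w comm_sum // => i y; apply: pfC.
  have := comm_sum B (fun i => iota (f i).@[coord z]) idfun.
  by move=> /= <- //; rewrite -/V !mulNr mulrA.
(* Otherwise every [v_j] is some [c_j V] modulo [Q], so [w] collapses to [h V] with [h] the sum of
   the [c_j f_j], and [V = h(z) V] modulo [Q] forces [h(z)] to be nonzero. *)
have vQ j : exists c, Q (v j - iota c * V).
  apply: Qrat => // x; apply: contrapT => Qx; apply: nj.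
  by exists j, x.
have [c cP] := choice vQ.
have pf0 : pf 0 = 0 by apply/funext => g; rewrite /pf meval0 rmorph0.
exists (\sum_j f j * (c j)%:MP), V; split=> //.
  have -> : pf (\sum_j f j * (c j)%:MP) * phi V =
      w + \sum_j pf (f j) * phi (- (v j - iota (c j) * V)).
    rewrite (big_morph pf pfD pf0) /w -big_split mulr_suml.
    apply: eq_bigr => j _ /=; rewrite pfM pfX -mulrA -mulrDr -rmorphM -rmorphD.
    by rewrite opprB addrC subrK.
  apply: QTD => //; apply: (big_ind (QT Q)).
  - by apply: QTK; apply: ideal0.
  - by move=> F1 F2; apply: QTD.
  - by move=> j _; apply: QTpf; apply: QTQ; apply: idealN.
apply/eqP => hz; apply: QV.
have -> : V = \sum_j iota (f j).@[coord z] * (v j - iota (c j) * V) +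
    iota (\sum_j f j * (c j)%:MP).@[coord z] * V.
  rewrite (raddf_sum (meval (coord z))) (raddf_sum iota) mulr_suml.
  rewrite -big_split /=.
  rewrite {1}/V; apply: eq_bigr => j _.
  by rewrite mevalM mevalC rmorphM mulrBr mulrA subrK.
rewrite hz rmorph0 mul0r addr0; apply: ideal_sum => j.
exact: idealMl.
Qed.

(** [x] comes from generic lying over. For [Q] avoiding it, the polynomials [f] with [f u] in [QT Q]
    for some [u] outside [Q] form a proper ideal. A common zero of it is a point [g] of [Z], and a
    [p] in [P] with [A g p] outside [Q] would be shortened to a member of the ideal not vanishing at
    [g]. *)
Lemma component_dominates : exists x, ~ transporter_ideal Z P x /\
  forall Q, prime_ideal Q -> rational_at Q -> transporter_ideal Z P `<=` Q ->
    ~ Q x -> exists2 z, Z z & forall p, P p -> Q (A z p).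
Proof.
have Jprime : prime_ideal (ideal_preim phi K).
  have := transporter_ideal_prime Zirr Pprime.
  by congr prime_ideal; apply: ideal_eq.
have [x [Jx xP]] := generic_lying_over mon0 monD (fun a => pfC 'X_[a]) Jprime.
exists x; split=> // Q Qprime Qrat JQ Qx; apply: contrapT => noz.
have vanish_in f : (forall z, Z z -> f.@[coord z] = 0) -> QT Q (pf f).
  move=> fZ; apply: QTK => z Zz; rewrite /pf fZ // !rmorph0.
  exact: ideal0.
pose bset : set {mpoly k[d]} :=
  [set f | exists2 u, ~ Q u & QT Q (pf f * phi u)].
have b_vanish f : (forall z, Z z -> f.@[coord z] = 0) -> bset f.
  move=> /vanish_in Qf; exists 1; first exact: prime_ideal1.
  by rewrite rmorph1 mulr1.
have bD f1 f2 : bset f1 -> bset f2 -> bset (f1 + f2).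
  move=> [u1 Qu1 b1] [u2 Qu2 b2].
  have [y Qy] : exists y, ~ Q (u1 * y * u2).
    by apply/existsNP => /(prime_idealM Qprime) [].
  exists (u1 * y * u2) => //; rewrite pfD mulrDl; apply: QTD.
    by rewrite -mulrA rmorphM mulrA; apply: QTr.
  by rewrite rmorphM mulrA pfC -mulrA; apply: QTl.
have bM p f : bset f -> bset (p * f).
  by move=> [u Qu bu]; exists u; rewrite // pfM -mulrA; apply: QTpf.
have b0 : bset 0 by apply: b_vanish => z _; rewrite meval0.
have bMr f p : bset f -> bset (f * p) by rewrite mulrC; apply: bM.
have [|c bc] := @weak_nullstellensatz k d (Ideal b0 bD bM bMr).
  move=> /= [u Qu [t [Qt Kt]]]; apply: Qu; apply: (xP Q Qprime JQ Qx _ t Qt).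
  by move: Kt; rewrite -(mpolyC1 d k) pfX !rmorph1 mul1r.
have [E GE] := @ag_closed k G.
have [g _ gc] : range coord c.
  rewrite GE => p Ep; apply: bc; apply: b_vanish => z _.
  have : range coord (coord z) by exists z.
  by rewrite GE; apply.
have Zg : Z g.
  by apply: Zclosed => p pZ; rewrite gc; apply: bc; apply: b_vanish.
have [p [Pp Qp]] : exists p, P p /\ ~ Q (A g p).
  apply: contrapT => nop; apply: noz; exists g => // p Pp.
  by apply: contrapT => Qp; apply: nop; exists p.
have [n [v [f fE]]] := orbit_regular p.
(* The relation to be shortened: the function [z |-> A z p] lies in [K], since its value at [z] is
   in [z.P]. *)
have [||h [u [Qu Qhu]]] := @shorten Q g n v f Qprime Qrat Zg.
- apply: QTK => z Zz; rewrite fct_sumE.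
  have -> : \sum_(i < n) (pf (f i) * phi (v i)) z = A z p by rewrite fE.
  by rewrite actK.
- by rewrite -fE.
by rewrite gc bc ?eqxx //; exists u.
Qed.

End Component.

Lemma minimal_index (n : nat) (J : nat -> ideal B) : (0 < n)%N ->
  exists2 i, (i < n)%N & forall j, (j < n)%N -> J j `<=` J i -> J i `<=` J j.
Proof.
elim: n => // n IHn _; have [->|n0] := posnP n.
  by exists 0%N => // j; rewrite ltnS leqn0 => /eqP->.
have [i ltin imin] := IHn n0.
have [Jni|Jni] := pselect (J n `<=` J i); last first.
  exists i; first exact: ltnW.
  by move=> j; rewrite ltnS leq_eqVlt => /predU1P[->|] //; apply: imin.
exists n => // j; rewrite ltnS leq_eqVlt => /predU1P[->//|ltjn Jjn].
by apply: (subset_trans Jni); apply: imin => //; apply: subset_trans Jni.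
Qed.

(** A rational prime over [P:G] lies over some [J i], so it is enough that [x] lie in every [I i],
    the intersection of the bad primes over [J i]. Such an [x] exists outside a minimal [J i0]: if
    [I i] were inside [J i0], minimality would give [I i = J i], against [component_dominates]. *)
Lemma orbit_dominates P : prime_ideal P ->
  exists x, ~ (forall g, P (A g x)) /\
  forall Q, prime_ideal Q -> rational_at Q ->
    (forall y, (forall g, P (A g y)) -> Q y) ->
    ~ Q x -> exists g, forall p, P p -> Q (A g p).
Proof.
move=> Pprime; have clT : alg_closed coord [set: G] by [].
have [n [Z [Zirr Zcl ZT]]] := alg_closed_decomposition clT.
pose J i := transporter_ideal (Z i) P.
have n0 : (0 < n)%N.
  by have [i ltin _] := (ZT 1%g).1 Logic.I; apply: leq_ltn_trans ltin.
pose bad i Q := [/\ prime_ideal Q, rational_at Q, J i `<=` Q &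
  ~ exists g, forall p, P p -> Q (A g p)].
have HA i : exists I : ideal B, forall x, I x <-> forall Q, bad i Q -> Q x.
  unshelve eexists.
    refine (@Ideal B [set x | forall Q, bad i Q -> Q x] _ _ _ _).
    - by move=> Q _; apply: ideal0.
    - by move=> x y Ix Iy Q bQ; apply: idealD; [apply: Ix | apply: Iy].
    - by move=> u x Ix Q bQ; apply: idealMl; apply: Ix.
    - by move=> x u Ix Q bQ; apply: idealMr; apply: Ix.
  by [].
have [I IE] := choice HA.
have [i0 lti0 i0min] := minimal_index J n0.
have [||x [xI Jx]] := @prime_ideal_finite_cap B (J i0) _ (index_iota 0 n) I.
- exact: transporter_ideal_prime (Zirr i0 lti0) Pprime.
- move=> i; rewrite mem_index_iota /= => lti; apply: contrapT => nox.
  have IJ : I i `<=` J i0.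
    by move=> x Ix; apply: contrapT => Jx; apply: nox; exists x.
  have JI : J i `<=` I i by move=> x Jx; apply/IE => Q [_ _ + _]; apply.
  have J0i := i0min i lti (subset_trans JI IJ).
  have [x [Jx xP]] := component_dominates (Zcl i lti) (Zirr i lti) Pprime.
  apply/Jx/J0i/IJ/IE => Q [Qprime Qrat JQ noz]; apply: contrapT => Qx.
  by have [z _ zP] := xP Q Qprime Qrat JQ Qx; apply: noz; exists z.
exists x; split=> [Px|Q Qprime Qrat PQ Qx].
  by apply: Jx => z _; apply: Px.
apply: contrapT => noz.
have [i [lti JQ]] : exists i, (i < n)%N /\ J i `<=` Q.
  apply: contrapT => noi.
  have [|y [yJ Qy]] := @prime_ideal_finite_cap B Q _ (index_iota 0 n) J Qprime.
    move=> i; rewrite mem_index_iota /= => lti; apply: contrapT => nox.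
    apply: noi; exists i; split=> // y Jy; apply: contrapT => Qy.
    by apply: nox; exists y.
  apply/Qy/PQ => g; have [i lti Zi] := (ZT g^-1%g).1 Logic.I.
  by have := yJ i; rewrite mem_index_iota lti => /(_ isT _ Zi); rewrite invgK.
have Ix : I i x by apply: xI; rewrite mem_index_iota.
by apply: Qx; have /IE := Ix; apply.
Qed.

End OrbitClosure.

(** * The Martindale ring of quotients *)

Section MartindaleTheory.
Variable U : pzRingType.
Local Notation Q := (martindale U).
Local Notation emb := (@mart_embed U).
Implicit Types (q r : Q) (u v : U).

Lemma mart_embed_is_zmod_morphism : zmod_morphism emb.
Proof.
move=> u v; rewrite -[RHS]/(mart_add _ (mart_opp _)) mart_oppE mart_addE.
by apply/mart_classP => x _ _ /=; rewrite mulrBl.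
Qed.
HB.instance Definition _ :=
  GRing.isZmodMorphism.Build U Q emb mart_embed_is_zmod_morphism.

Lemma mart_embed_is_monoid_morphism : monoid_morphism emb.
Proof.
split=> // u v; rewrite -[RHS]/(mart_mul _ _) mart_mulE.
by apply/mart_classP => x _ _ /=; rewrite mulrA.
Qed.
HB.instance Definition _ :=
  GRing.isMonoidMorphism.Build U Q emb mart_embed_is_monoid_morphism.

Lemma mart_embed0 : emb 0 = 0. Proof. exact: raddf0. Qed.
Lemma mart_embedD u v : emb (u + v) = emb u + emb v.
Proof. exact: raddfD. Qed.
Lemma mart_embedM u v : emb (u * v) = emb u * emb v.
Proof. exact: rmorphM. Qed.
Lemma mart_embed_sum n (F : 'I_n -> U) :
  emb (\sum_(i < n) F i) = \sum_(i < n) emb (F i).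
Proof. exact: raddf_sum. Qed.

Lemma mart_embed_inj : injective emb.
Proof.
by move=> u v /mart_classP /(_ 1 Logic.I Logic.I) /=; rewrite !mulr1.
Qed.

Lemma mart_classM (f : dense_hom U) d :
  dh_dom f d -> mart_class f * emb d = emb (f d).
Proof.
move=> fd; rewrite -[LHS]/(mart_mul _ _) mart_mulE.
by apply/mart_classP => x _ _ /=; rewrite dh_mulr.
Qed.

Lemma mart_dense q : exists D : ideal U, dense_ideal D /\
  forall d, D d -> exists u, q * emb d = emb u.
Proof.
rewrite -[q]mart_classK; move: (repr q) => f; exists (dh_dom f).
split; first exact: dh_dense.
by move=> d fd; exists (f d); rewrite mart_classM.
Qed.

Lemma mart_eq0 q (D : ideal U) :
  dense_ideal D -> (forall d, D d -> q * emb d = 0) -> q = 0.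
Proof.
rewrite -[q]mart_classK; move: (repr q) => f dD fD0.
apply/eqmodP/asboolP; exists (idealI (dh_dom f) D).
split=> [|x []||x [fx Dx]] //; first exact: denseI (dh_dense f) dD.
have := fD0 x Dx; rewrite mart_classM // -mart_embed0.
exact: mart_embed_inj.
Qed.

(** Where [p] maps [a] into [U], both [q p a] and [p q a] equal [q (p a)], and a dense ideal of such
    [a] exists. *)
Lemma mart_centralP q :
  (forall u, q * emb u = emb u * q) -> extended_centroid U q.
Proof.
move=> qC p; apply/eqP; rewrite -subr_eq0; apply/eqP.
have [D [dD Dq]] := mart_dense q; have [E [dE Ep]] := mart_dense p.
apply: (mart_eq0 (denseM dE dD)) => _ [n [a [b [Ea Db ->]]]].
rewrite mart_embed_sum mulr_sumr big1 // => i _.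
have [u pu] := Ep _ (Ea i).
rewrite mart_embedM mulrBl !mulrA -(mulrA q p) pu -(mulrA p q) (qC (a i)).
by rewrite mulrA pu qC subrr.
Qed.

Definition kill_ideal q (qC : extended_centroid U q) : ideal U.
Proof.
refine (@Ideal U [set d | q * emb d = 0] _ _ _ _).
- by rewrite /mkset mart_embed0 mulr0.
- by move=> x y; rewrite /mkset mart_embedD mulrDr => -> ->; rewrite addr0.
- by move=> u x qx; rewrite /mkset mart_embedM mulrA qC -mulrA qx mulr0.
- by move=> x u; rewrite /mkset mart_embedM mulrA => ->; rewrite mul0r.
Defined.

Section MultiplierFromPairs.
Variables (S : Type) (a b : S -> U).
Hypothesis ab : forall s t x, a s * x * b t = b s * x * a t.
Hypothesis a_dense : forall u, (forall s x, u * x * a s = 0) -> u = 0.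

(** The graph of the bimodule map sending [a s] to [b s], on the ideal generated by the [a s]. The
    family will be a single pair for prime ideals and an orbit for [G]-prime ones. *)
Inductive pair_rel : U -> U -> Prop :=
| pair_rel0 : pair_rel 0 0
| pair_relS x s y u v of pair_rel u v :
    pair_rel (x * a s * y + u) (x * b s * y + v).

Lemma pair_relD u1 v1 u2 v2 :
  pair_rel u1 v1 -> pair_rel u2 v2 -> pair_rel (u1 + u2) (v1 + v2).
Proof.
elim=> [|x s y u v _ IH] r2; first by rewrite !add0r.
by rewrite -!addrA; apply: pair_relS; apply: IH.
Qed.

Lemma pair_relMl w u v : pair_rel u v -> pair_rel (w * u) (w * v).
Proof.
elim=> [|x s y {}u {}v _ IH]; first by rewrite mulr0; apply: pair_rel0.
by rewrite !mulrDr !mulrA; apply: pair_relS.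
Qed.

Lemma pair_relMr w u v : pair_rel u v -> pair_rel (u * w) (v * w).
Proof.
elim=> [|x s y {}u {}v _ IH]; first by rewrite !mul0r; apply: pair_rel0.
by rewrite !mulrDl -!(mulrA _ y); apply: pair_relS.
Qed.

Lemma pair_rel_cross u v s z : pair_rel u v -> u * z * b s = v * z * a s.
Proof.
elim=> [|x t y {}u {}v _ IH]; first by rewrite !mul0r.
have E := ab t s (y * z); rewrite !mulrA in E.
by rewrite !mulrDl IH -!mulrA; congr (x * _ + _); rewrite !mulrA.
Qed.

(** Each value [v] of [u] satisfies [u x b_s = v x a_s], so the difference of two values annihilates
    all the [x a_s]. *)
Lemma pair_rel_fun u v1 v2 : pair_rel u v1 -> pair_rel u v2 -> v1 = v2.
Proof.
move=> r1 r2; apply/eqP; rewrite -subr_eq0; apply/eqP/a_dense => s x.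
by rewrite !mulrBl -(pair_rel_cross s x r1) -(pair_rel_cross s x r2) subrr.
Qed.

Lemma pair_rel1 x s y : pair_rel (x * a s * y) (x * b s * y).
Proof. by have := pair_relS x s y pair_rel0; rewrite !addr0. Qed.

Definition pair_ideal : ideal U.
Proof.
refine (@Ideal U [set u | exists v, pair_rel u v] _ _ _ _).
- by exists 0; apply: pair_rel0.
- by move=> x y [v xv] [w yw]; exists (v + w); apply: pair_relD.
- by move=> u x [v xv]; exists (u * v); apply: pair_relMl.
- by move=> x u [v xv]; exists (v * u); apply: pair_relMr.
Defined.

Lemma pair_ideal_dense : dense_ideal pair_ideal.
Proof.
apply/dense_idealP => u uD; apply: a_dense => s x; rewrite -mulrA.
apply: uD; exists (x * b s).
by have := pair_rel1 x s 1; rewrite !mulr1.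
Qed.

Lemma multiplier_from_pairs :
  exists2 q, extended_centroid U q & forall s, q * emb (a s) = emb (b s).
Proof.
have exf u : exists v, pair_ideal u -> pair_rel u v.
  have [[v uv]|nu] := pselect (pair_ideal u); first by exists v.
  by exists 0.
have [f fP] := choice exf.
have fE u v : pair_rel u v -> f u = v.
  by move=> uv; apply: (pair_rel_fun _ uv); apply: fP; exists v.
have fD x y : pair_ideal x -> pair_ideal y -> f (x + y) = f x + f y.
  by move=> /fP fx /fP fy; apply: fE; apply: pair_relD.
have fM x u : pair_ideal x -> f (x * u) = f x * u.
  by move=> /fP fx; apply: fE; apply: pair_relMr.
pose F := DenseHom pair_ideal_dense fD fM.
exists (mart_class F) => [|s].
  apply: mart_centralP => u; apply/eqP; rewrite -subr_eq0; apply/eqP.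
  apply: (mart_eq0 pair_ideal_dense) => d Dd.
  have Fud : F (u * d) = u * f d by apply: fE; apply: pair_relMl; apply: fP.
  have Dud : pair_ideal (u * d) by apply: idealMl.
  rewrite mulrBl -!mulrA -mart_embedM (@mart_classM F _ Dud).
  by rewrite (@mart_classM F _ Dd) -mart_embedM Fud subrr.
have sas : pair_rel (a s) (b s).
  by have := pair_rel1 1 s 1; rewrite !mul1r !mulr1.
by rewrite mart_classM; [rewrite (_ : F _ = b s) //; apply: fE | exists (b s)].
Qed.

End MultiplierFromPairs.

Section PrimeRing.
Hypothesis U1 : (1 : U) <> 0.
Hypothesis Uprime : forall u v, (forall x, u * x * v = 0) -> u = 0 \/ v = 0.

Lemma dense_nonzero (D : ideal U) : dense_ideal D -> exists2 d, D d & d <> 0.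
Proof.
move=> /dense_idealP dD; apply: contrapT => noD; apply: U1; apply: dD => d Dd.
by rewrite mul1r; apply: contrapT => d0; apply: noD; exists d.
Qed.

Lemma mart_nonzero q : q <> 0 -> exists d u, q * emb d = emb u /\ u <> 0.
Proof.
move=> q0; have [D [dD Dq]] := mart_dense q.
apply: contrapT => nodu; apply: q0; apply: (mart_eq0 dD) => d Dd.
have [u qd] := Dq d Dd; rewrite qd; have [->|u0] := pselect (u = 0).
  by rewrite mart_embed0.
by case: nodu; exists d, u.
Qed.

Lemma mart_prime q r : (forall x, q * emb x * r = 0) -> q = 0 \/ r = 0.
Proof.
move=> qr; apply: contrapT => /not_orP[q0 r0].
have [d [u [qd u0]]] := mart_nonzero q0.
have [e [v [re v0]]] := mart_nonzero r0.
have [x||] // := @Uprime u v.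
apply: mart_embed_inj.
rewrite !mart_embedM -qd -re -(mulrA q) -mart_embedM mulrA.
by rewrite qr mul0r mart_embed0.
Qed.

End PrimeRing.

End MartindaleTheory.

(** * Elementwise forms of rationality *)

Lemma quot_proj_mul (U : pzRingType) (I : ideal U) u v :
  quot_proj I (u * v) = quot_proj I u * quot_proj I v.
Proof. exact: quot_projM. Qed.

Lemma quot_proj_mul3 (U : pzRingType) (I : ideal U) a x b :
  quot_proj I a * quot_proj I x * quot_proj I b = quot_proj I (a * x * b).
Proof. by rewrite !quot_proj_mul. Qed.

Section QuotientPrime.
Variables (U : pzRingType) (P : ideal U).
Hypothesis Pprime : prime_ideal P.
Local Notation pr := (@quot_proj U P).

Lemma quot_proj0 u : pr u = 0 <-> P u.
Proof. by rewrite -(raddf0 pr) quot_projP subr0. Qed.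

Lemma quot_prime1 : (1 : quot_ring P) <> 0.
Proof. by move/quot_proj0; apply: prime_ideal1. Qed.

Lemma quot_prime u v :
  (forall x, u * x * v = 0) -> u = 0 \/ v = 0 :> quot_ring P.
Proof.
rewrite -[u]quot_projK -[v]quot_projK => uv.
have [x||] := prime_idealM (a := repr u) (b := repr v) Pprime.
- by apply/quot_proj0; rewrite !quot_proj_mul; apply: uv.
- by move/quot_proj0; left.
- by move/quot_proj0; right.
Qed.

End QuotientPrime.

Section RationalPrime.
Variables (k : closedFieldType) (R : algType k) (P : spec R).
Local Notation pr := (@quot_proj R P).
Local Notation emb := (@mart_embed (quot_ring P)).

Lemma quot_scalar_central (I : ideal R) c :
  extended_centroid (quot_ring I) (quot_scalar I c).
Proof.
apply: mart_centralP => u; rewrite /quot_scalar -!mart_embedM.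
rewrite -[u]quot_projK -!quot_proj_mul; congr (mart_embed (quot_proj _ _)).
by rewrite mulr_algl mulr_algr.
Qed.

Lemma quot_projE (I : ideal R) a b c : I (b - c%:A * a) ->
  quot_proj I b = quot_proj I c%:A * quot_proj I a.
Proof. by rewrite -quot_proj_mul => /quot_projP. Qed.

(** From left to right, [a |-> b] extends to a central multiplier. Conversely a central [q] maps
    some nonzero [d] to a [w] in [R/P]; once [w = c d], the central element [q - c] kills [d] and
    vanishes by primeness. *)
Lemma RatSpecP : RatSpec R P <-> rational_at (in_alg R : {rmorphism k -> R}) P.
Proof.
have Pprime := spec_prime P.
have P1 := quot_prime1 Pprime; have PM := @quot_prime _ _ Pprime.
split=> [CP a b Pa Pab|Prat].
  have [|u uP|q qC qa] :=
    @multiplier_from_pairs _ unit (fun=> pr a) (fun=> pr b).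
  - move=> _ _ x; rewrite -[x]quot_projK !quot_proj_mul3; apply/quot_projP.
    exact: Pab.
  - have [x||/quot_proj0//] // := PM u (pr a).
    exact: uP tt x.
  have [c _ qE] : range (quot_scalar P) q by rewrite -CP.
  exists c; apply/quot_projP; rewrite [RHS]quot_proj_mul.
  by apply: mart_embed_inj; rewrite -(qa tt) -qE mart_embedM.
apply/seteqP; split=> [q qC|_ [c _ <-]]; last exact: quot_scalar_central.
have [D [dD Dq]] := mart_dense q.
have [d Dd d0] := dense_nonzero P1 dD.
have [w qd] := Dq d Dd.
have [|x|c Pc] := Prat (repr d) (repr w).
- by move=> /quot_proj0; rewrite quot_projK.
- apply/quot_projP; rewrite !quot_proj_mul !quot_projK; apply: mart_embed_inj.
  rewrite !mart_embedM -qd mulrA -(qC (emb d * _)) mulrA.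
  by [].
exists c => //; apply/eqP; rewrite eq_sym -subr_eq0; apply/eqP.
have rC : extended_centroid (quot_ring P) (q - quot_scalar P c).
  by move=> p; rewrite mulrBl mulrBr qC quot_scalar_central.
have rd : (q - quot_scalar P c) * emb d = 0.
  rewrite mulrBl qd -mart_embedM -{1}[w]quot_projK (quot_projE Pc).
  by rewrite quot_projK subrr.
have [x||] // := @mart_prime _ PM (q - quot_scalar P c) (emb d).
  by rewrite rC -mulrA rd mulr0.
by rewrite -mart_embed0 => /mart_embed_inj.
Qed.

End RationalPrime.

Section GPrime.
Variables (G : groupType) (U : pzRingType) (A : ring_action G U).
Implicit Types (I J : gideal A) (P : ideal U).

Lemma gideal_eq I J : I = J :> set U -> I = J.
Proof.
case: I J => [I sI] [J sJ] /= IJ; have E := ideal_eq IJ; subst J.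
by congr GIdeal; apply: Prop_irrelevance.
Qed.

(** As for prime ideals, except that the colon ideal is taken against the whole orbit of [a], which
    makes it [G]-stable. *)
Lemma gprimeM I u a :
  GSpec A I -> (forall g x, I (u * x * A g a)) -> I u \/ I a.
Proof.
move=> [_ Iprime] uIa.
have sL g x : colon_left I [set A h a | h in setT] x ->
    colon_left I [set A h a | h in setT] (A g x).
  move=> Lx y _ [h _ <-].
  have -> : A g x * y * A h a = A g (x * A g^-1%g y * A (g^-1 * h)%g a).
    by rewrite !rmorphM actM !actVK.
  by apply: gideal_stable; apply: Lx; exists (g^-1 * h)%g.
pose L := GIdeal sL.
have sM g x : colon_right I L x -> colon_right I L (A g x).
  move=> Mx y v Lv.
  have -> : v * y * A g x = A g (A g^-1%g v * A g^-1%g y * x).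
    by rewrite !rmorphM !actVK.
  by apply: gideal_stable; apply: Mx; apply: gideal_stable.
pose M := GIdeal sM.
have [|LI|MI] := Iprime L M.
- by apply: ideal_mul_sub => v w Lv Mw; rewrite -(mulr1 v); apply: Mw.
- by left; apply: LI => x _ [g _ <-].
- right; apply: MI => x v Lv; apply: Lv; exists 1%g => //; exact: act1.
Qed.

Definition core P : gideal A.
Proof.
unshelve refine (@GIdeal _ _ A
  (@Ideal U [set x | forall g, P (A g x)] _ _ _ _) _).
- by move=> g; rewrite rmorph0; apply: ideal0.
- by move=> x y Px Py g; rewrite rmorphD; apply: idealD; auto.
- by move=> u x Px g; rewrite rmorphM; apply: idealMl; auto.
- by move=> x u Px g; rewrite rmorphM; apply: idealMr; auto.
- by move=> g x Px h; rewrite -actM; apply: Px.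
Defined.

Lemma core_sub P : core P `<=` P.
Proof. by move=> x /(_ 1%g); rewrite act1. Qed.

Lemma sub_core I P : I `<=` P -> I `<=` core P.
Proof. by move=> IP x Ix g; apply: IP; apply: gideal_stable. Qed.

Lemma core_mono P1 P2 : P1 `<=` P2 -> core P1 `<=` core P2.
Proof. by move=> P12 x Px g; apply: P12. Qed.

Lemma core_prime P : prime_ideal P -> GSpec A (core P).
Proof.
move=> Pprime; split=> [PT|J K JK].
  apply: (prime_ideal1 Pprime); apply: core_sub.
  by rewrite -[X in X 1]/(ideal_set (core P)) PT.
have [_ /(_ J K)] := Pprime; case=> [x /JK /core_sub//||] /sub_core; auto.
Qed.

Lemma gspec1 I : GSpec A I -> ~ I 1.
Proof.
move=> [IT _] I1; apply: IT; apply/seteqP; split=> // x _.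
by rewrite -[x]mulr1; apply: idealMl.
Qed.

End GPrime.

Section GRational.
Variables (k : closedFieldType) (R : algType k) (G : groupType).
Variable A : ring_action G R.
Hypothesis A_linear : forall g, scalable (A g).
Variable I : gideal A.
Hypothesis Igprime : GSpec A I.
Local Notation pr := (@quot_proj R I).
Local Notation emb := (@mart_embed (quot_ring I)).

Lemma act_alg g c : A g c%:A = c%:A.
Proof. by rewrite A_linear rmorph1. Qed.

(** The relations say that [A g a |-> A g b] defines a [G]-invariant central multiplier; those
    between two arbitrary points of the orbit follow by translation. *)
Definition grational_at := forall a b, ~ I a ->
  (forall g x, I (A g a * x * b - A g b * x * a)) -> exists c, I (b - c%:A * a).

Lemma gquot_prime u a :
  (forall g x, u * x * quot_action I g a = 0) -> u = 0 \/ a = 0.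
Proof.
rewrite -[u]quot_projK -[a]quot_projK => ua.
have [g x||] := gprimeM (u := repr u) (a := repr a) Igprime.
- apply/quot_proj0; rewrite !quot_proj_mul; have := ua g (pr x).
  by rewrite /= quot_actE.
- by move/quot_proj0; left.
- by move/quot_proj0; right.
Qed.

(** The annihilator of a central [r] is a two-sided ideal; since it contains the orbit of a nonzero
    [a], it is dense because [I] is [G]-prime. *)
Lemma kill_orbit r a : extended_centroid (quot_ring I) r ->
  (forall g, r * emb (quot_action I g a) = 0) -> a <> 0 -> r = 0.
Proof.
move=> rC ra a0; apply: (@mart_eq0 _ r (kill_ideal rC)) => [|d //].
apply/dense_idealP => u uK.
have [g x||] // := @gquot_prime u a.
by rewrite -mulrA; apply: uK; apply: idealMl; apply: ra.
Qed.

Lemma GRatSpecP : GRatSpec A I <-> grational_at.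
Proof.
have I1 := gspec1 Igprime.
split=> [[_ CI] a b Ia Iab|Irat].
  have pa : pr a <> 0 by move/quot_proj0.
  have [s t x|u uP|q qC qa] := @multiplier_from_pairs _ G
      (fun g => pr (A g a)) (fun g => pr (A g b)).
  - rewrite -[x]quot_projK !quot_proj_mul3; apply/quot_projP.
    have := gideal_stable t (Iab (t^-1 * s)%g (A t^-1%g (repr x))).
    by rewrite rmorphB !rmorphM !actM !actVK.
  - have [g x||] // := @gquot_prime u (pr a).
    by rewrite /= quot_actE; apply: uP.
  have qG : fixed_points (mart_action (quot_action I)) q.
    move=> g; apply/eqP; rewrite -subr_eq0; apply/eqP.
    apply: (kill_orbit _ _ pa) => [p|h].
      rewrite mulrBl mulrBr qC; congr (_ - _).
      rewrite -[p](actVK (mart_action (quot_action I)) g) -!rmorphM.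
      by rewrite qC.
    rewrite mulrBl /= quot_actE qa.
    have -> : emb (pr (A h a)) =
        mart_action (quot_action I) g (emb (pr (A (g^-1 * h)%g a))).
      by rewrite /= mart_act_embed /= quot_actE -actM mulVKg.
    rewrite -rmorphM qa /= mart_act_embed /= quot_actE -actM mulVKg.
    exact: subrr.
  have [c _ qE] : range (quot_scalar I) q by rewrite -CI.
  exists c; apply/quot_projP; rewrite [RHS]quot_proj_mul.
  have := qa 1%g; rewrite !act1 => qa1.
  by apply: mart_embed_inj; rewrite -qa1 -qE mart_embedM.
split=> //; apply/seteqP; split=> [q [qC qG]|_ [c _ <-]]; last first.
  split; first exact: quot_scalar_central.
  by move=> g /=; rewrite mart_act_embed /= quot_actE act_alg.
have U1 : (1 : quot_ring I) <> 0 by move/quot_proj0.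
have [D [dD Dq]] := mart_dense q.
have [d Dd d0] := dense_nonzero U1 dD.
have [w qd] := Dq d Dd.
have qgd g : q * emb (quot_action I g d) = emb (quot_action I g w).
  by rewrite -!mart_act_embed -{1}(qG g) -qd [RHS]rmorphM.
have [|g x|c Ic] := Irat (repr d) (repr w).
- by move=> /quot_proj0; rewrite quot_projK.
- apply/quot_projP; rewrite !quot_proj_mul !quot_projK -!(quot_actE I g).
  rewrite !quot_projK.
  apply: mart_embed_inj; rewrite !mart_embedM -qd mulrA -(qC (emb _ * _)) mulrA.
  by rewrite qgd.
exists c => //; apply/eqP; rewrite eq_sym -subr_eq0; apply/eqP.
have rC : extended_centroid (quot_ring I) (q - quot_scalar I c).
  by move=> p; rewrite mulrBl mulrBr qC quot_scalar_central.
apply: (kill_orbit rC _ d0) => g.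
rewrite mulrBl qgd -mart_embedM -{1}[w]quot_projK (quot_projE Ic) quot_projK.
have -> : quot_action I g (pr c%:A * d) = pr c%:A * quot_action I g d.
  by rewrite [LHS]rmorphM /= quot_actE act_alg.
by rewrite mart_embedM subrr.
Qed.

End GRational.

(** * Consequences of the action being rational *)

Section RationalAction.
Variables (k : closedFieldType) (G : affine_group k) (R : algType k).
Variable A : ring_action G R.
Hypothesis A_linear : forall g, scalable (A g).
Hypothesis A_rational : rational_action A.
Local Notation iota := (in_alg R : {rmorphism k -> R}).
Local Notation coord := (@ag_coord k G).
Implicit Types (P Q J : ideal R) (I : gideal A).

Lemma act_lincomb g n (c : 'I_n -> k) (v : 'I_n -> R) :
  A g (\sum_(i < n) c i *: v i) = \sum_(i < n) c i *: A g (v i).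
Proof. by rewrite rmorph_sum; apply: eq_bigr => i _; apply: A_linear. Qed.

Lemma in_algC c (b : R) : iota c * b = b * iota c.
Proof. by rewrite /= mulr_algl mulr_algr. Qed.

Lemma rational_orbit_regular (b : R) : exists n (v : 'I_n -> R)
  (f : 'I_n -> {mpoly k[ag_dim G]}),
  forall g, A g b = \sum_(i < n) iota (f i).@[coord g] * v i.
Proof.
have [n [v [rho [_ [c ->] [_ _ rhoP _] Av]]]] := A_rational b.
have rhoP' i : exists p : 'I_n -> {mpoly k[ag_dim G]},
    forall j g, rho g i j = (p j).@[coord g].
  by have [p pE] := choice (rhoP i); exists p.
have [p pE] := choice rhoP'.
exists n, v, (fun i => \sum_j (p i j) * (c j)%:MP) => g.
rewrite act_lincomb; under eq_bigr => j _ do rewrite Av scaler_sumr.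
rewrite exchange_big; apply: eq_bigr => i _ /=.
rewrite (raddf_sum (meval (coord g))) scaler_suml mulr_suml.
apply: eq_bigr => j _ /=.
by rewrite mevalM mevalC -pE mulr_algl scalerA mulrC.
Qed.

Section SpanCoordinates.
Variables (n : nat) (v : 'I_n -> R) (rho : G -> 'M[k]_n).
Hypothesis Av : forall g j, A g (v j) = \sum_(i < n) rho g i j *: v i.

Definition comb (u : 'rV[k]_n) : R := \sum_i u 0 i *: v i.

Lemma act_comb g u : A g (comb u) = comb (u *m (rho g)^T).
Proof.
rewrite /comb act_lincomb; under eq_bigr => j _ do rewrite Av scaler_sumr.
rewrite exchange_big; apply: eq_bigr => i _ /=.
rewrite mxE scaler_suml; apply: eq_bigr => j _.
by rewrite mxE scalerA.
Qed.

Lemma comb_row_space P :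
  exists M : 'M[k]_n, forall u, P (comb u) <-> (u <= M)%MS.
Proof.
apply: (@subspace_row_space k n [set u | P (comb u)]).
- rewrite /mkset /comb big1 ?ideal0 // => [|i _]; first exact: ideal0.
  by rewrite mxE scale0r.
- move=> u w Pu Pw; rewrite /mkset /comb.
  under eq_bigr do rewrite mxE scalerDl.
  by rewrite big_split; apply: idealD.
- move=> c u Pu; rewrite /mkset /comb.
  under eq_bigr do rewrite mxE -scalerA.
  by rewrite -scaler_sumr -mulr_algl; apply: idealMl.
Qed.

End SpanCoordinates.

(** In a finite-dimensional [G]-stable space containing [x], the part lying in [P] is mapped by [g]
    injectively into itself, hence onto itself. *)
Lemma stable_under_inverse P g :
  (forall x, P x -> P (A g x)) -> forall x, P x -> P (A g^-1%g x).
Proof.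
move=> Pg x Px.
have [n [v [rho [_ [c xE] [rho1 rhoM _ _] Av]]]] := A_rational x.
have [M PM] := comb_row_space v P.
have uT : (rho g)^T \in unitmx.
  rewrite unitmx_tr; have : rho g *m rho g^-1%g = 1%:M by rewrite -rhoM mulgV.
  by case/mulmx1_unit.
have MgM : (M *m (rho g)^T <= M)%MS.
  apply/row_subP => i; rewrite row_mul -PM -(act_comb Av).
  by apply/Pg/PM; apply: row_sub.
have MMg : (M <= M *m (rho g)^T)%MS.
  have [_] := mxrank_leqif_eq MgM.
  by rewrite mxrankMfree ?row_free_unit // eqxx => /esym/andP[].
have xc : x = comb v (\row_i c i).
  by rewrite xE; apply: eq_bigr => i _; rewrite mxE.
have cM : (\row_i c i <= M)%MS by apply/PM; rewrite -xc.
have /submxP[D cE] := submx_trans cM MMg.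
rewrite xc cE mulmxA -(act_comb Av) actK.
by apply/PM; apply: submxMl.
Qed.

(** The orbit of [x] stays in a finite-dimensional space, and finitely many vectors spanning its
    part inside the union [V] already lie in one member of the chain. *)
Lemma core_chain (C : set (ideal R)) (V : ideal R) x :
  C !=set0 ->
  (forall J1 J2, C J1 -> C J2 -> J1 `<=` J2 \/ J2 `<=` J1) ->
  (forall x, V x <-> exists2 J, C J & J x) ->
  core A V x -> exists2 J, C J & core A J x.
Proof.
move=> [I0 CI0] Ctot VE Vx.
have [n [v [rho [_ [c xE] [rho1 rhoM _ _] Av]]]] := A_rational x.
have [M VM] := comb_row_space v V.
have [I CI IM] : exists2 J, C J & forall i, J (comb v (row i M)).
  have upto m : (m <= n)%N -> exists2 J, C J &
      forall i : 'I_n, (i < m)%N -> J (comb v (row i M)).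
    elim: m => [|m IHm] ltmn; first by exists I0.
    have [I CI Im] := IHm (ltnW ltmn).
    have /VE[J CJ Jm] : V (comb v (row (Ordinal ltmn) M)).
      by apply/VM; apply: row_sub.
    have mE (i : 'I_n) : i = m :> nat -> i = Ordinal ltmn.
      by move=> im; apply: val_inj.
    have [IJ|JI] := Ctot I J CI CJ.
      exists J => // i; rewrite ltnS leq_eqVlt => /predU1P[/mE->//|/Im].
      exact: IJ.
    exists I => // i; rewrite ltnS leq_eqVlt => /predU1P[/mE->|/Im//].
    exact: JI.
  by have [I CI In] := upto n (leqnn n); exists I => // i; apply: In.
exists I => // g; have [N IN] := comb_row_space v I.
have xc : x = comb v (\row_i c i).
  by rewrite xE; apply: eq_bigr => i _; rewrite mxE.
rewrite xc (act_comb Av); apply/IN; apply: (@submx_trans _ _ _ _ _ _ M).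
  by apply/VM; rewrite -(act_comb Av) -xc; apply: Vx.
by apply/row_subP => i; apply/IN; apply: IM.
Qed.

(** Zorn's lemma, with [core_chain] for the unions. [P] is prime because two ideals not inside [P]
    enlarge it to ideals whose cores are not inside the [G]-prime [I]. With [I] for [Q0] this makes
    every [G]-prime the core of a prime. *)
Lemma maximal_core I Q0 : GSpec A I -> core A Q0 `<=` I ->
  exists P : spec R, [/\ Q0 `<=` P, core A P `<=` I &
    forall J, P `<=` J -> core A J `<=` I -> J `<=` P].
Proof.
move=> Iprime Q0I.
have [//|C V C0 CF Ctot VE x|P [PI Q0P Pmax]] :=
    @ideal_zorn R (fun J => core A J `<=` I) Q0.
  by move=> /(core_chain C0 Ctot VE)[J CJ]; apply: CF.
have Pprime : prime_ideal P.
  split=> [PT|J K JK].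
    by apply: (gspec1 Iprime); apply: PI => g; rewrite rmorph1 PT.
  apply: contrapT => /not_orP[JP KP].
  have notcore (L : ideal R) : ~ L `<=` P -> ~ core A (ideal_add P L) `<=` I.
    move=> LP cI; apply: LP => x Lx; apply: (Pmax (ideal_add P L)) => //.
      by move=> y Py; exists y, 0; rewrite addr0; split=> //; apply: ideal0.
    by exists 0, x; rewrite add0r; split=> //; apply: ideal0.
  have [_ /(_ (core A (ideal_add P J)) (core A (ideal_add P K)))] := Iprime.
  case; [|exact: notcore|exact: notcore].
  have PJK : ideal_mul (ideal_add P J) (ideal_add P K) `<=` P.
    apply: ideal_mul_sub => _ _ [p [j [Pp Jj ->]]] [p' [l [Pp' Kl ->]]].
    rewrite mulrDl; apply: idealD; first exact: idealMr.
    rewrite mulrDr; apply: idealD; first exact: idealMl.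
    by apply: JK; apply: ideal_mulW.
  apply: subset_trans PI => x xJK g; apply: PJK.
  move: x xJK => _ [m [a [b [aJ bK ->]]]].
  rewrite rmorph_sum; apply: ideal_sum => i; rewrite rmorphM.
  by apply: ideal_mulW; [apply: aJ | apply: bK].
by exists (Spec Pprime).
Qed.

Lemma rational_at_translate Q h :
  rational_at iota Q -> rational_at iota (ideal_preim (A h) Q).
Proof.
move=> Qrat a b Qa Qab.
have [x|c Qc] := Qrat (A h a) (A h b) Qa.
  by have [y <-] := act_surj A h x; rewrite -!rmorphM -rmorphB; apply: Qab.
exists c; rewrite /ideal_preim /= rmorphB rmorphM.
by rewrite act_alg.
Qed.

Lemma prime_translate Q h : prime_ideal Q -> prime_ideal (ideal_preim (A h) Q).
Proof.
move=> Qprime; apply: prime_idealW => [|a b Qab].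
  by rewrite /ideal_preim /= rmorph1; apply: prime_ideal1.
apply: (prime_idealM Qprime) => x.
by have [y <-] := act_surj A h x; rewrite -!rmorphM; apply: Qab.
Qed.

(** The exceptional element [x] is outside the common core, so some translate of [Q] avoids it, and
    [orbit_dominates] applies to that translate. *)
Lemma rational_orbit_sub P Q : prime_ideal P -> prime_ideal Q ->
  rational_at iota Q -> core A P = core A Q ->
  exists g, forall x, P x -> Q (A g x).
Proof.
move=> Pprime Qprime Qrat PQ.
have [x [Px xP]] := orbit_dominates in_algC rational_orbit_regular Pprime.
have [h Qhx] : exists h, ~ Q (A h x).
  apply: contrapT => noh; apply: Px; suff: core A P x by [].
  by rewrite PQ => h; apply: contrapT => Qhx; apply: noh; exists h.
have [y Py|//|g gP] :=
  xP _ (@prime_translate Q h Qprime) (@rational_at_translate Q h Qrat).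
  by have : core A Q y; [rewrite -PQ | apply].
by exists (h * g)%g => p Pp; rewrite actM; apply: gP.
Qed.

Lemma spec_eq (P Q : spec R) : (forall x, P x <-> Q x) -> P = Q.
Proof.
case: P Q => [P Pp] [Q Qp] /= PQ.
have E : P = Q by apply: ideal_eq; apply/seteqP; split=> x /PQ.
by subst Q; congr Spec; apply: Prop_irrelevance.
Qed.

(** Each prime contains a translate of the other, so a product [g h] maps [Q] into itself;
    [stable_under_inverse] reverses this inclusion. *)
Lemma rational_same_orbit (P Q : spec R) : RatSpec R P -> RatSpec R Q ->
  core A P = core A Q -> exists g, Q = spec_act A g P.
Proof.
move=> /RatSpecP Prat /RatSpecP Qrat PQ.
have [g gP] := rational_orbit_sub (spec_prime P) (spec_prime Q) Qrat PQ.
have [h hQ] := rational_orbit_sub (spec_prime Q) (spec_prime P) Prat (esym PQ).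
exists g; apply: spec_eq => x.
rewrite [X in _ <-> X](act_idealP A g P x).
split=> [Qx|/gP]; last by rewrite actVK.
have ghQ y : Q y -> Q (A (g * h)%g y) by move=> /hQ /gP; rewrite actM.
have := stable_under_inverse ghQ Qx; rewrite invgM actM => /hQ.
by rewrite actVK.
Qed.

Lemma core_grational (P : spec R) : RatSpec R P -> GRatSpec A (core A P).
Proof.
move=> /RatSpecP Prat; have cP := core_prime A (spec_prime P).
apply/(GRatSpecP A_linear cP) => a b /existsNP[g0 Pa] Pab.
have Ph h x : P (A g0 a * x * A h b - A g0 b * x * A h a).
  have := Pab (h^-1 * g0)%g (A h^-1%g x) h.
  by rewrite rmorphB !rmorphM -!actM mulVKg mulgV act1.
have [x|c Pc] := Prat (A g0 a) (A g0 b) Pa.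
  exact: (Ph g0 x).
(* The scalar found for [A g0 a] and [A g0 b] serves every [h], since all the
   [A g0 a * x * A h (b - c a)] are in [P] and [A g0 a] is not. *)
exists c => h.
have [|//|//] := prime_idealM (spec_prime P) (a := A g0 a)
  (b := A h (b - c%:A * a)).
  move=> x; rewrite rmorphB rmorphM act_alg //.
  have -> : A g0 a * x * (A h b - c%:A * A h a) =
      (A g0 a * x * A h b - A g0 b * x * A h a) +
      (A g0 b - iota c * A g0 a) * x * A h a.
    rewrite mulrBr !mulrBl addrA subrK; congr (_ - _).
    by rewrite mulrA -(in_algC c (_ * _)) !mulrA.
  by apply: idealD => //; apply: idealMr; apply: idealMr.
Qed.

End RationalAction.

(** * Maximal primes in a G-rational stratum *)

Section CentralEvaluation.
Variables (R : nzRingType) (S : pzRingType) (f : {rmorphism R -> S}) (u : S).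

(* horner_morph needs a nontrivial target ring. *)
Definition central_eval (uC : forall x, u * x = x * u) (p : {poly R}) : S :=
  \sum_(i < size p) f p`_i * u ^+ i.

Variable uC : forall x, u * x = x * u.
Local Notation ev := (central_eval uC).

Lemma central_eval_widen n (p : {poly R}) : (size p <= n)%N ->
  ev p = \sum_(i < n) f p`_i * u ^+ i.
Proof.
move=> len; rewrite /central_eval.
rewrite (big_ord_widen n (fun i => f p`_i * u ^+ i)) //.
rewrite big_mkcond; apply: eq_bigr => i _ /=.
by case: ltnP => // lei; rewrite nth_default // rmorph0 mul0r.
Qed.

Lemma central_eval_is_zmod_morphism : zmod_morphism ev.
Proof.
move=> p q; pose n := maxn (size p) (size q).
rewrite !(@central_eval_widen n) ?leq_maxl ?leq_maxr //; last first.
  by rewrite (leq_trans (size_polyD _ _)) // size_polyN.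
rewrite -sumrB; apply: eq_bigr => i _.
by rewrite coefB rmorphB mulrBl.
Qed.
HB.instance Definition _ :=
  GRing.isZmodMorphism.Build {poly R} S ev central_eval_is_zmod_morphism.

Lemma central_evalC c : ev c%:P = f c.
Proof.
rewrite (@central_eval_widen 1) ?size_polyC_leq1 // big_ord1 expr0 mulr1.
by rewrite coefC.
Qed.

Lemma central_evalMX p : ev (p * 'X) = ev p * u.
Proof.
rewrite (@central_eval_widen (size p).+1); last first.
  by rewrite (leq_trans (size_polyMleq _ _)) // size_polyX addnC.
rewrite big_ord_recl coefMX eqxx rmorph0 mul0r add0r mulr_suml.
by apply: eq_bigr => i _; rewrite coefMX /= exprSr mulrA.
Qed.

Lemma central_evalMC p c : ev (p * c%:P) = ev p * f c.
Proof.
rewrite (@central_eval_widen (size p)); last first.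
  by apply/leq_sizeP => i lei; rewrite coefMC nth_default // mul0r.
rewrite mulr_suml; apply: eq_bigr => i _.
have uiC j x : u ^+ j * x = x * u ^+ j.
  by apply/commr_sym/commrX; rewrite /GRing.comm uC.
by rewrite coefMC rmorphM -!mulrA uiC.
Qed.

Lemma central_eval_is_monoid_morphism : monoid_morphism ev.
Proof.
split=> [|p q]; first by rewrite central_evalC rmorph1.
elim/poly_ind: q => [|q c IHq]; first by rewrite mulr0 !raddf0 mulr0.
rewrite mulrDr mulrA !raddfD /= !central_evalMX IHq central_evalMC.
by rewrite central_evalC mulrDr mulrA.
Qed.
HB.instance Definition _ :=
  GRing.isMonoidMorphism.Build {poly R} S ev central_eval_is_monoid_morphism.

Lemma central_evalX : ev 'X = u.
Proof. by rewrite -['X]mul1r central_evalMX rmorph1 mul1r. Qed.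

End CentralEvaluation.

Section PolyAction.
Variables (G : groupType) (R : nzRingType) (A : ring_action G R).

Definition poly_action : ring_action G {poly R}.
Proof.
refine (@RingAction _ _ (fun g => map_poly (A g) : {rmorphism _ -> _}) _ _).
- by move=> p; apply/polyP => i; rewrite coef_map /= act1.
- by move=> g h p; apply/polyP => i; rewrite !coef_map /= actM.
Defined.

Lemma coef_poly_action g p i : (poly_action g p)`_i = A g p`_i.
Proof. by rewrite /= coef_map. Qed.

Lemma poly_actionC g c : poly_action g c%:P = (A g c)%:P.
Proof. by rewrite /= map_polyC. Qed.

Lemma poly_actionX g : poly_action g 'X = 'X.
Proof. by rewrite /= map_polyX. Qed.

End PolyAction.

Lemma closed_field_distinct (k : closedFieldType) n :
  exists s : seq k, uniq s /\ size s = n.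
Proof.
elim: n => [|n [s [us <-]]]; first by exists [::].
have [|c cs] := @closed_field_nonroot k (\prod_(z <- s) ('X - z%:P)).
  exact/monic_neq0/monic_prod_XsubC.
exists (c :: s); split=> //=; rewrite us andbT.
by apply: contra cs => cs; rewrite -/(root _ _) root_prod_XsubC.
Qed.

Section PolyValues.
Variables (k : closedFieldType) (R : algType k) (I : ideal R).

(** Factors ['X - c] are divided out one point after another. Differences of distinct scalars are
    invertible, so the quotient has values in [I] at the remaining points, and [size F] points are
    enough. *)
Lemma poly_values_in_ideal (F : {poly R}) :
  (forall c : k, I F.[c%:A]) -> forall i, I F`_i.
Proof.
move=> IF; have [s [us sF]] := closed_field_distinct k (size F).
have {IF} Fs : forall c, c \in s -> I F.[c%:A] by move=> c _.
elim: s F us sF Fs => [|c s IHs] F /=.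
  move=> _ /esym/eqP; rewrite size_poly_eq0 => /eqP-> _ i.
  by rewrite coef0; apply: ideal0.
move=> /andP[cs us] sF Fs.
have /factor_theorem[q qE] : root (F - F.[c%:A]%:P) c%:A.
  by rewrite /root !hornerE subrr.
have FE : F = q * ('X - (c%:A)%:P) + F.[c%:A]%:P by rewrite -qE subrK.
have IC : I F.[c%:A] by apply: Fs; rewrite mem_head.
have Iq : forall i, I q`_i.
  apply: IHs => //.
    have [q0|q0] := eqVneq q 0.
      move: sF; rewrite FE q0 mul0r add0r size_polyC.
      by case: (s) => [|? ?]; rewrite ?size_poly0 //; case: eqP.
    have sq : size (q * ('X - (c%:A)%:P)) = (size q).+1.
      by rewrite size_Mmonic ?monicXsubC // size_XsubC addn2.
    move: sF; rewrite FE size_polyDl ?sq; first by case.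
    by rewrite (leq_ltn_trans (size_polyC_leq1 _)) // ltnS size_poly_gt0.
  move=> d ds; have := Fs d; rewrite in_cons ds orbT => /(_ isT).
  rewrite {1}FE hornerD hornerC => /idealB /(_ IC); rewrite addrK.
  rewrite hornerM_comm; last first.
    by rewrite /comm_poly hornerXsubC -scalerBl mulr_algl mulr_algr.
  rewrite hornerXsubC -scalerBl => Iqd.
  have dc : d - c != 0 by rewrite subr_eq0; apply: contraNneq cs => <-.
  have := idealMr ((d - c)^-1%:A) Iqd.
  by rewrite -mulrA -scalerAl mul1r scalerA mulfV // scale1r mulr1.
move=> i; rewrite FE coefD coefC; apply: idealD.
  rewrite mulrBr coefB coefMX coefMC; apply: idealB; last exact: idealMr.
  by case: i => [|i] /=; [apply: ideal0 | apply: Iq].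
by case: i => [|i] /=; [ | apply: ideal0].
Qed.

End PolyValues.

Section PolyOrbitRegular.
Variables (k : closedFieldType) (G : affine_group k) (R : algType k).
Variable A : ring_action G R.
Hypothesis A_linear : forall g, scalable (A g).
Hypothesis A_rational : rational_action A.
Local Notation iota := (in_alg R : {rmorphism k -> R}).
Local Notation coord := (@ag_coord k G).

Definition poly_scalar : {rmorphism k -> {poly R}} := polyC \o in_alg R.

Lemma poly_scalarC c (F : {poly R}) : poly_scalar c * F = F * poly_scalar c.
Proof.
apply/polyP => i; rewrite coefCM coefMC.
by rewrite mulr_algl mulr_algr.
Qed.

Let regular (F : {poly R}) := exists n (v : 'I_n -> {poly R})
  (f : 'I_n -> {mpoly k[ag_dim G]}),
  forall g, poly_action A g F = \sum_(i < n) poly_scalar (f i).@[coord g] * v i.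

Lemma poly_orbit_regular F : regular F.
Proof.
have regD F1 F2 : regular F1 -> regular F2 -> regular (F1 + F2).
  move=> [m [v [f fE]]] [n [w [h hE]]].
  exists (m + n)%N, (pair_coord v w), (pair_coord f h) => g.
  rewrite raddfD /= -/(poly_action A g F1) -/(poly_action A g F2).
  rewrite big_split_ord /pair_coord /=; congr (_ + _).
    by rewrite [LHS]fE; apply: eq_bigr => i _; rewrite (unsplitK (inl i)).
  by rewrite [LHS]hE; apply: eq_bigr => i _; rewrite (unsplitK (inr i)).
elim/poly_ind: F => [|F c IHF].
  by exists 0%N, (fun=> 0), (fun=> 0) => g; rewrite raddf0 big_ord0.
apply: regD.
  have [n [v [f fE]]] := IHF; exists n, (fun i => v i * 'X), f => g.
  rewrite rmorphM poly_actionX fE mulr_suml; apply: eq_bigr => i _.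
  by rewrite mulrA.
have [n [v [f fE]]] := rational_orbit_regular A_linear A_rational c.
exists n, (fun i => (v i)%:P), f => g.
rewrite poly_actionC fE rmorph_sum; apply: eq_bigr => i _.
by rewrite rmorphM.
Qed.

End PolyOrbitRegular.

Section MaximalCoreRational.
Variables (k : closedFieldType) (G : affine_group k) (R : algType k).
Variable A : ring_action G R.
Hypothesis A_linear : forall g, scalable (A g).
Hypothesis A_rational : rational_action A.
Variables (I : gideal A) (P : spec R).
Hypothesis Irat : GRatSpec A I.
Hypothesis IP : I `<=` P.
Hypothesis PI : core A P `<=` I.
Hypothesis Pmax : forall J : ideal R, P `<=` J -> core A J `<=` I -> J `<=` P.
Hypothesis I_rational_cap : forall x,
  (forall Q : spec R, RatSpec R Q -> I `<=` Q -> Q x) -> I x.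

Local Notation iota := (in_alg R : {rmorphism k -> R}).
Local Notation pr := (@quot_proj R P).
Local Notation M := (martindale (quot_ring P)).
Let f : {rmorphism R -> M} := @mart_embed (quot_ring P) \o pr.

Variable kappa : M.
Hypothesis kappaC : extended_centroid (quot_ring P) kappa.
Hypothesis kappa_scalar : forall c, kappa <> quot_scalar P c.

Let Pprime := spec_prime P.
Let Iprime : GSpec A I. Proof. by case: Irat. Qed.
Local Notation ev := (central_eval f kappaC).

Let f0 x : f x = 0 <-> P x.
Proof.
rewrite -quot_proj0 /f /=; split=> [|->]; last exact: mart_embed0.
by rewrite -(mart_embed0 (quot_ring P)) => /mart_embed_inj.
Qed.

Let f_prime q r : (forall x, q * f x * r = 0) -> q = 0 \/ r = 0.
Proof.
move=> qr; apply: (mart_prime (quot_prime Pprime)) => x.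
by rewrite -[x]quot_projK; apply: qr.
Qed.

Let f_scalar c : f c%:A = quot_scalar P c. Proof. by []. Qed.

Let central_prime q r :
  extended_centroid (quot_ring P) q -> q * r = 0 -> q = 0 \/ r = 0.
Proof. by move=> qC qr; apply: f_prime => x; rewrite qC -mulrA qr mulr0. Qed.

Let P1 : ~ P 1. Proof. exact: prime_ideal1. Qed.

(** [p] splits over [k], so its value at [kappa] is a nonzero scalar times factors [kappa - z],
    which are central and nonzero, hence regular. *)
Let transcendental (p : {poly k}) : p != 0 -> ev (map_poly (in_alg R) p) <> 0.
Proof.
have roots0 s : ev (map_poly (in_alg R) (\prod_(z <- s) ('X - z%:P))) <> 0.
  elim: s => [|z s IHs].
    by rewrite big_nil !rmorph1 -(rmorph1 f) => /f0 /P1.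
  rewrite big_cons !rmorphM rmorphB /= map_polyX map_polyC rmorphB /=.
  rewrite central_evalX central_evalC f_scalar => kz.
  have [|/eqP|//] := central_prime _ kz.
    by move=> q; rewrite mulrBl mulrBr kappaC quot_scalar_central.
  by rewrite subr_eq0 => /eqP /kappa_scalar.
move=> p0; have [s ->] := closed_field_poly_normal p.
rewrite -mul_polyC !rmorphM /= map_polyC central_evalC f_scalar.
move=> ps0; have [|/f0 Pc|/roots0//] := central_prime _ ps0.
  exact: quot_scalar_central.
rewrite -lead_coef_eq0 in p0; apply: P1; rewrite -(scale1r 1) -(mulVf p0).
by rewrite -scalerA -mulr_algl; apply: idealMl.
Qed.

Definition eval_ideal : ideal {poly R} := ideal_preim ev (zero_ideal M).

Lemma eval_ideal_prime : prime_ideal eval_ideal.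
Proof.
apply: prime_idealW => [|F H FH].
  by rewrite /eval_ideal /= rmorph1 -(rmorph1 f) => /f0 /P1.
have [x||] := @f_prime (ev F) (ev H); [|by left|by right].
by rewrite -(central_evalC f kappaC x) -!rmorphM; apply: FH.
Qed.

Let P_I x : I x -> forall g, P (A g x).
Proof. by move=> Ix g; apply/IP/gideal_stable. Qed.

Lemma eval_ideal_coef (F : {poly R}) : (forall i, I F`_i) ->
  forall g, eval_ideal (poly_action A g F).
Proof.
move=> IF g; rewrite /eval_ideal /= /mkset /central_eval big1 // => i _.
by rewrite coef_poly_action (_ : f _ = 0) ?mul0r //; apply/f0/P_I.
Qed.

(* Linear disjointness: the relations over C(R/I)^G = k between the powers of
   kappa are those over k, hence trivial. *)
Lemma eval_ideal_core (F : {poly R}) :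
  (forall g, eval_ideal (poly_action A g F)) -> forall i, I F`_i.
Proof.
have [n] := ubnP (size F); elim: n F => // n IHn F; rewrite ltnS => leFn FP.
have [F0 i|F0] := eqVneq F 0; first by rewrite F0 coef0; apply: ideal0.
set m := (size F).-1; set a := lead_coef F.
have szF : size F = m.+1 by rewrite prednK // size_poly_gt0.
have shorter (H : {poly R}) :
    (size H <= size F)%N -> H`_m = 0 -> (size H < n)%N.
  move=> leHF H0; apply: leq_trans leFn; rewrite szF ltnS.
  apply/leq_sizeP => j; rewrite leq_eqVlt => /predU1P[<-//|ltmj].
  by rewrite nth_default // (leq_trans leHF) // szF.
have [Ia|nIa] := pselect (I a).
  pose H := F - a%:P * 'X^m.
  have IH : forall i, I H`_i.
    apply: IHn => [|g].
      apply: shorter; last by rewrite coefB coefCM coefXn eqxx mulr1 subrr.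
      apply/leq_sizeP => j lej; rewrite coefB coefCM coefXn.
      rewrite nth_default // sub0r (gtn_eqF (_ : m < j)%N) ?mulr0 ?oppr0 //.
      by rewrite -szF.
    rewrite rmorphB; apply: idealB => //; apply: eval_ideal_coef => i.
    by rewrite coefCM; apply: idealMr.
  move=> i; rewrite -[F](subrK (a%:P * 'X^m)) coefD; apply: idealD => //.
  by rewrite coefCM; apply: idealMr.
(* [H] is in the kernel together with its translates and has lost the leading term, so the induction
   hypothesis applies to it. *)
have Icross y g i : I (a * y * A g F`_i - F`_i * y * A g a).
  pose H := (a * y)%:P * poly_action A g F - F * (y * A g a)%:P.
  have -> : a * y * A g F`_i - F`_i * y * A g a = H`_i.
    by rewrite coefB coefCM coefMC coef_poly_action mulrA.
  apply: (IHn H) => [|h].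
    apply: shorter.
      apply/leq_sizeP => j lej; rewrite coefB coefCM coefMC coef_poly_action.
      have A0 : A g 0 = 0 by exact: rmorph0.
      by rewrite !(nth_default 0 lej) A0 mulr0 mul0r subrr.
    by rewrite coefB coefCM coefMC coef_poly_action mulrA subrr.
  rewrite rmorphB !rmorphM; apply: idealB; last by apply: idealMr.
  by apply: idealMl; rewrite -actM.
(* [G]-rationality gives [F = p a] modulo [I] with [p] over [k]. Then [ev p] kills the image of
   every [A g a]; being central and nonzero it is regular, so the orbit of [a] is in [P] and [a] is
   in [I]. *)
have coefP i : exists c, I (F`_i - c%:A * a).
  have Igr := (GRatSpecP A_linear Iprime).1 Irat; apply: Igr => // g x.
  have := gideal_stable g (Icross (A g^-1%g x) g^-1%g i).
  by rewrite rmorphB !rmorphM !actVK.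
have [c cP] := choice coefP.
pose p := \poly_(i < m.+1) (if i == m then 1 else c i).
have pE i : I (F`_i - (p`_i)%:A * a).
  rewrite coef_poly ltnS; case: ltngtP => [ltim|ltmi|->].
  - exact: cP.
  - rewrite scale0r mul0r nth_default ?subrr; first exact: ideal0.
    by rewrite szF.
  - rewrite scale1r mul1r /a lead_coefE subrr; exact: ideal0.
have p0 : p != 0.
  apply/eqP => /(congr1 (fun q : {poly k} => q`_m)).
  rewrite coef_poly ltnSn eqxx coef0 => /eqP.
  by rewrite oner_eq0.
case: nIa; apply: PI => g.
pose H := F - map_poly (in_alg R) p * a%:P.
have HP : eval_ideal (poly_action A g H).
  by apply: eval_ideal_coef => i; rewrite coefB coefMC coef_map; apply: pE.
have pg : poly_action A g (map_poly (in_alg R) p) = map_poly (in_alg R) p.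
  by apply/polyP => i; rewrite !coef_map /= act_alg.
have : eval_ideal (poly_action A g (map_poly (in_alg R) p * a%:P)).
  have -> : map_poly (in_alg R) p * a%:P = F - H by rewrite opprB addrC subrK.
  by rewrite rmorphB; apply: idealB.
rewrite rmorphM pg poly_actionC /eval_ideal /= /mkset rmorphM.
have tC : extended_centroid (quot_ring P) (ev (map_poly (in_alg R) p)).
  move=> q; rewrite /central_eval mulr_suml mulr_sumr; apply: eq_bigr => i _.
  have kq : kappa ^+ i * q = q * kappa ^+ i.
    by apply/commr_sym/commrX; rewrite /GRing.comm kappaC.
  have fq : f (map_poly (in_alg R) p)`_i * q = q * f (map_poly (in_alg R) p)`_i.
    by rewrite coef_map; apply: quot_scalar_central.
  by rewrite -mulrA kq !mulrA fq.
move=> /(central_prime tC) [/(transcendental p0)//|].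
by move=> ga; apply/f0; rewrite -(central_evalC f kappaC).
Qed.

(* For generic c every generic rational ideal contains a translate of
   P + (b - c a), where kappa a = b; so this ideal still has core I. *)
Lemma nonscalar_absurd : False.
Proof.
have [F0 [F0P domF0]] := orbit_dominates (poly_scalarC (R := R))
  (poly_orbit_regular A_linear A_rational) eval_ideal_prime.
(* If all scalar values of [F0] were in [I], so would be its coefficients, and every translate of
   [F0] would be in [eval_ideal]. *)
have [c Ic] : exists c : k, ~ I F0.[c%:A].
  apply: contrapT => noc; apply: F0P; apply: eval_ideal_coef.
  apply: poly_values_in_ideal => c; apply: contrapT => Ic.
  by apply: noc; exists c.
have U1 := quot_prime1 Pprime.
have [D [dD Dk]] := mart_dense kappa.
have [d Dd d0] := dense_nonzero U1 dD.
have [w kd] := Dk d Dd.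
pose a := repr d; pose b := repr w.
have fa : f a <> 0.
  by rewrite /f /= quot_projK -(mart_embed0 (quot_ring P)) => /mart_embed_inj.
have kab : kappa * f a = f b by rewrite /f /= !quot_projK.
pose e := b - c%:A * a.
have Pe : ~ P e.
  move/f0; rewrite rmorphB rmorphM -kab -mulrBl => /central_prime[|/eqP|//].
    by move=> q; rewrite mulrBl mulrBr kappaC quot_scalar_central.
  by rewrite subr_eq0 => /eqP; apply: kappa_scalar.
pose J := ideal_add P (ideal_gen [set e]).
have cC (y : R) : c%:A * y = y * c%:A by rewrite mulr_algl mulr_algr.
pose evc : {rmorphism {poly R} -> R} := central_eval idfun cC.
have evcC y : evc y%:P = y by exact: (central_evalC idfun cC).
have evcX : evc 'X = c%:A by exact: (central_evalX idfun cC).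
apply: Pe; apply: (Pmax (J := J)).
- by move=> x Px; exists x, 0; rewrite addr0; split=> //; apply: ideal0.
- move=> x Jx.
  (* As [F0.[c]] is outside [I], it suffices that its translates multiply [x] into [I], which is
     tested on rational primes [Q] over [I]. If [Q] misses [A g F0.[c]], the pullback of [g^-1.Q]
     along [X |-> c] is a rational prime of [{poly R}] missing [F0], so it contains a translate of
     [eval_ideal]. *)
  have [g y|//|/Ic[]] := gprimeM (u := x) (a := F0.[c%:A]) Iprime.
  apply: I_rational_cap => Q /RatSpecP Qrat IQ.
  have [Qv|Qv] := pselect (Q (A g F0.[c%:A])); first exact: idealMl.
  apply: idealMr; apply: idealMr.
  pose Q' := ideal_preim (A g) Q.
  have Q'prime : prime_ideal Q' := prime_translate A g (spec_prime Q).
  have Q'rat : rational_at iota Q' :=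
    rational_at_translate A_linear (h := g) Qrat.
  have evcE F : evc F = F.[c%:A] by rewrite horner_coef.
  pose q := ideal_preim evc Q'.
  have qE F : q F <-> Q' (evc F) by [].
  have qprime : prime_ideal q.
    apply: prime_idealW => [/qE|F H FH].
      by rewrite rmorph1; apply: prime_ideal1.
    apply: (prime_idealM Q'prime) => t.
    by rewrite -(evcC t) -!rmorphM; apply: FH.
  have qrat : rational_at (poly_scalar R) q.
    move=> F H qF qFH.
    have [t|l Ql] := Q'rat (evc F) (evc H) qF.
      by rewrite -(evcC t) -!rmorphM -rmorphB; apply: qFH.
    exists l; apply/qE; rewrite rmorphB rmorphM.
    by rewrite evcC.
  have [F FP||h hP] := domF0 q qprime qrat.
  - apply/qE; rewrite evcE horner_coef; apply: ideal_sum => i; apply: idealMr.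
    by apply/IQ/gideal_stable; apply: eval_ideal_core FP i.
  - by move/qE; rewrite evcE.
  have JQ' t : J t -> Q' (A h t).
    move=> [p [z [Pp Jz ->]]]; rewrite rmorphD; apply: idealD.
      have : q (poly_action A h p%:P).
        by apply: hP; rewrite /eval_ideal /= /mkset central_evalC; apply/f0.
      by move/qE; rewrite poly_actionC evcC.
    move: z Jz; rewrite -/(subset _ (ideal_preim (A h) Q')) ideal_gen_sub.
    move=> _ ->; have : q (poly_action A h (b%:P - a%:P * 'X)).
      apply: hP; rewrite /eval_ideal /= /mkset rmorphB rmorphM.
      by rewrite /= !central_evalC central_evalX -kappaC kab subrr.
    move/qE; rewrite rmorphB rmorphM !poly_actionC poly_actionX.
    rewrite rmorphB rmorphM !evcC evcX.
    rewrite -[ideal_preim (A h) Q' e]/(Q' (A h e)) rmorphB rmorphM act_alg //.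
    by rewrite cC.
  have := JQ' _ (Jx (h^-1 * g^-1)%g).
  by rewrite actM actVK /Q' /ideal_preim /= /mkset actVK.
- by exists 0, e; rewrite add0r; split=> //; [apply: ideal0 | move=> L; apply].
Qed.

End MaximalCoreRational.

Lemma maximal_core_rational (k : closedFieldType) (G : affine_group k)
    (R : algType k) (A : ring_action G R) (I : gideal A) (P : spec R) :
  (forall g, scalable (A g)) -> rational_action A -> GRatSpec A I ->
  I `<=` P -> core A P `<=` I ->
  (forall J : ideal R, P `<=` J -> core A J `<=` I -> J `<=` P) ->
  (forall x, (forall Q : spec R, RatSpec R Q -> I `<=` Q -> Q x) -> I x) ->
  RatSpec R P.
Proof.
move=> Alin Arat Irat IP PI Pmax Icap.
apply/seteqP; split=> [q qC|_ [c _ <-]]; last exact: quot_scalar_central.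
apply: contrapT => noq.
apply: (nonscalar_absurd Alin Arat Irat IP PI Pmax Icap qC) => c qc.
by apply: noq; exists c.
Qed.

(** * Annihilators of simple modules *)

Section SimpleModules.
Variables (k : closedFieldType) (R : algType k) (V : lmodType R^c).
Hypothesis Vsimple : simple_module V.

Lemma conv_scaleM (a b : R) (v : V) :
  ((a * b : R) : R^c) *: v = (b : R^c) *: ((a : R^c) *: v).
Proof. by rewrite scalerA. Qed.

Lemma simple_module_gen (v w : V) : v != 0 -> exists a : R, w = (a : R^c) *: v.
Proof.
move=> v0.
pose W : {pred V} := fun w => `[< exists a : R, w = (a : R^c) *: v >].
have Wclosed : submod_closed W.
  split; first by apply/asboolP; exists 0; rewrite scale0r.
  move=> c x y /asboolP[a ->] /asboolP[b ->]; apply/asboolP.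
  by exists (a * c + b); rewrite scalerDl conv_scaleM.
have [W0|WT] := Vsimple.2 W Wclosed; last first.
  by apply/asboolP; rewrite -[`[< _ >]]/(w \in W) WT.
have : v \in W by apply/asboolP; exists 1; rewrite scale1r.
by rewrite W0 inE (negPf v0).
Qed.

Lemma simple_module_ann_prime (P : ideal R) :
  ideal_set P = module_ann V -> prime_ideal P.
Proof.
move=> PV; apply: prime_idealW => [|a b]; rewrite PV.
  have [v v0] := Vsimple.1; move=> /(_ v); rewrite scale1r => /eqP.
  by rewrite (negPf v0).
move=> Vab; apply: contrapT => /not_orP[/existsNP[v /eqP va] Vb].
apply: Vb => w; have [x ->] := simple_module_gen w va.
by rewrite -!conv_scaleM mulrA; apply: Vab.
Qed.

(** In right module notation, [v0 a y |-> v0 b y] is a well-defined map on [V] commuting with all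
    endomorphisms. It is therefore a scalar [c], and [b - c a] kills [V]. *)
Lemma simple_module_ann_rational (P : ideal R) :
  ideal_set P = module_ann V ->
  (forall phi : {linear V -> V}, central_endomorphism phi <->
     exists c : k, forall v, phi v = (c%:A : R^c) *: v) ->
  rational_at (in_alg R : {rmorphism k -> R}) P.
Proof.
move=> PV Vend a b; rewrite PV => /existsNP[v0 /eqP va] Vab.
have ab (x : R) (v : V) : (b : R^c) *: ((x : R^c) *: ((a : R^c) *: v)) =
    (a : R^c) *: ((x : R^c) *: ((b : R^c) *: v)).
  have /(_ v) := Vab x; rewrite scalerBl => /subr0_eq.
  by rewrite !conv_scaleM.
have gen (w : V) : exists y : R, w = (y : R^c) *: ((a : R^c) *: v0).
  exact: simple_module_gen.
have [r rP] := choice gen.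
(* If [v0 a y = 0] but [v0 b y] is nonzero, then [v0 = v0 b y z] for some [z], and
   [v0 a = v0 b y z a = v0 a y z b = 0]. *)
have zero (y : R) : (y : R^c) *: ((a : R^c) *: v0) = 0 ->
    (y : R^c) *: ((b : R^c) *: v0) = 0.
  move=> yav; apply: contrapT => /eqP ybv.
  have [z vz] := simple_module_gen v0 ybv.
  case/eqP: va; rewrite {1}vz -(conv_scaleM y z) -ab (conv_scaleM y z).
  by rewrite yav !scaler0.
pose phi (w : V) : V := ((r w : R) : R^c) *: ((b : R^c) *: v0).
have phiE (y : R) :
    phi ((y : R^c) *: ((a : R^c) *: v0)) = (y : R^c) *: ((b : R^c) *: v0).
  have /zero : ((r ((y : R^c) *: ((a : R^c) *: v0)) - y : R) : R^c) *:
      ((a : R^c) *: v0) = 0 by rewrite scalerBl -rP subrr.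
  by rewrite scalerBl => /subr0_eq.
have phi_lin : linear phi.
  move=> c x y; rewrite {1}(rP x) {1}(rP y) (scalerA c) -scalerDl phiE.
  by rewrite scalerDl -scalerA.
pose Phi : {linear V -> V} :=
  HB.pack phi (GRing.isLinear.Build _ _ _ _ phi phi_lin).
have phia (u : V) : Phi ((a : R^c) *: u) = (b : R^c) *: u.
  have [y ->] := gen u; rewrite -conv_scaleM [LHS]phiE conv_scaleM.
  by rewrite ab.
have [c phic] : exists c : k, forall v, Phi v = (c%:A : R^c) *: v.
  apply/Vend => psi w; have [y ->] := gen w.
  have psiZ d x : psi (d *: x) = d *: psi x by exact: linearZ.
  have PhiZ d x : Phi (d *: x) = d *: Phi x by exact: linearZ.
  by rewrite /comp psiZ psiZ PhiZ phia -[Phi _]/(phi _) phiE psiZ psiZ.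
exists c => u; rewrite scalerBl -phia phic.
have -> : in_alg R c * a = a * c%:A by rewrite /= mulr_algl mulr_algr.
by rewrite conv_scaleM subrr.
Qed.

End SimpleModules.

(** * Finite families of G-stable ideals and avoidance for G-primes *)

HB.instance Definition _ (G : groupType) (U : pzRingType)
  (A : ring_action G U) := gen_eqMixin (gideal A).
HB.instance Definition _ (G : groupType) (U : pzRingType)
  (A : ring_action G U) := gen_choiceMixin (gideal A).

Lemma finite_image_factor (S T V : Type) (f : S -> T) (h : S -> V) (X : set S) :
  (forall x y, X x -> X y -> f x = f y -> h x = h y) ->
  finite_set (f @` X) -> finite_set (h @` X).
Proof.
move=> fh finf; have [->|/set0P[x0 Xx0]] := eqVneq X set0.
  by rewrite image_set0; apply: finite_set0.
have exl t : exists v, forall x, X x -> f x = t -> v = h x.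
  have [[x [Xx <-]]|nx] := pselect (exists x, X x /\ f x = t).
    by exists (h x) => y Xy yx; apply: fh.
  by exists (h x0) => x Xx xt; case: nx; exists x.
have [l lP] := choice exl.
apply: sub_finite_set (finite_image l finf) => _ [x Xx <-].
by exists (f x); [exists x | apply: lP].
Qed.

Section FiniteFamilies.
Variables (G : groupType) (U : pzRingType) (A : ring_action G U).
Implicit Types (I J : gideal A) (S : set (gideal A)).

(** Such an [I] is the intersection of the members of [S] above it, so a subset of the finite [S]
    determines it. *)
Lemma finite_gideal_caps S : finite_set S ->
  finite_set [set I : gideal A |
    forall x, (forall J, S J -> I `<=` J -> J x) -> I x].
Proof.
move=> /finite_seqP[l ->]; set X := [set I | _].
pose f I : (size l).-tuple bool := 
  map_tuple (fun J => `[< I `<=` J >]) (in_tuple l).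
rewrite -[X]image_id; apply: (@finite_image_factor _ _ _ f); last first.
  exact: finite_finset.
move=> I1 I2 X1 X2 /(congr1 val) /= f12.
have I12 J : J \in l -> I1 `<=` J <-> I2 `<=` J.
  move=> lJ.
  have := eq_in_map (fun J => `[< I1 `<=` J >]) (fun J => `[< I2 `<=` J >]) l.
  move=> [_ /(_ f12) E]; have := E J lJ.
  by split=> IJ; apply/asboolP; [rewrite -E // | rewrite E //]; apply/asboolP.
apply: gideal_eq; apply/seteqP; split=> x Ix; [apply: X2|apply: X1] => J lJ IJ.
  by apply: (I12 J lJ).2 IJ _ Ix.
by apply: (I12 J lJ).1 IJ _ Ix.
Qed.

Lemma finite_gideal_acc S (u : nat -> gideal A) : finite_set S ->
  (forall n, S (u n)) -> (forall n, u n `<=` u n.+1) ->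
  exists N, forall n, (N <= n)%N -> u n = u N.
Proof.
move=> /finite_seqP[l ->] ul uS.
have mono a b : (a <= b)%N -> u a `<=` u b.
  elim: b => [|b IHb]; first by rewrite leqn0 => /eqP->.
  by rewrite leq_eqVlt => /predU1P[->//|/IHb uab] x /uab /uS.
have [J Jinf] : exists J, forall m, exists n, (m <= n)%N /\ u n = J.
  apply: contrapT => noJ.
  have bound J : exists m, forall n, (m <= n)%N -> u n <> J.
    apply: contrapT => nom; apply: noJ; exists J => m; apply: contrapT => non.
    by apply: nom; exists m => n lemn unJ; apply: non; exists n.
  have [m mP] : exists m, forall J, J \in l -> forall n, (m <= n)%N -> u n <> J.
    elim: l {ul} => [|J l [m mP]]; first by exists 0%N.
    have [m' m'P] := bound J; exists (maxn m m') => J'.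
    rewrite in_cons => /predU1P[->|lJ'] n; rewrite geq_max => /andP[lem lem'].
      exact: m'P.
    exact: mP.
  exact: mP (ul m) m (leqnn m) erefl.
have [N [_ uN]] := Jinf 0%N; exists N => n leNn.
have [n' [len' un']] := Jinf n.
apply: gideal_eq; apply/seteqP; split; last exact: mono.
by rewrite uN -un'; apply: mono.
Qed.

(** [G]-prime avoidance: [s] is a product with one factor from each larger [J], spaced by means of
    [gprimeM] so as to stay outside [I]. *)
Lemma gspec_separating (l : seq (gideal A)) I : GSpec A I ->
  exists s, ~ I s /\ forall J, J \in l -> I `<=` J -> ~ J `<=` I -> J s.
Proof.
move=> Iprime; elim: l => [|J l [s [Is sP]]].
  by exists 1; split=> //; apply: gspec1.
have [[IJ JI]|nJ] := pselect (I `<=` J /\ ~ J `<=` I); last first.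
  exists s; split=> // J'; rewrite in_cons => /predU1P[->|/sP//] IJ JI.
  by case: nJ.
have [a [Ja Ia]] : exists a, J a /\ ~ I a.
  apply: contrapT => noa; apply: JI => a Ja; apply: contrapT => Ia.
  by apply: noa; exists a.
have [g [x Isxa]] : exists g x, ~ I (s * x * A g a).
  apply: contrapT => nogx; have [g x||] // := gprimeM (u := s) (a := a) Iprime.
  by apply: contrapT => Isxa; apply: nogx; exists g, x.
exists (s * x * A g a); split=> // J'.
rewrite in_cons => /predU1P[->|lJ'] IJ' J'I.
  by apply: idealMl; apply: gideal_stable.
by apply: idealMr; apply: idealMr; apply: sP.
Qed.

Lemma spec_actE g (P : spec U) x : spec_act A g P x <-> P (A g^-1%g x).
Proof. exact: act_idealP. Qed.

Lemma stratumE I (P : spec U) : stratum I P <-> I = core A P.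
Proof.
have capE : \bigcap_(g in [set: G]) (spec_act A g P : set U) = core A P.
  apply/seteqP; split=> [x Px g|x Px g _]; last by apply/spec_actE.
  by have /spec_actE := Px g^-1%g Logic.I; rewrite invgK.
by rewrite /stratum /= capE; split=> [/esym/gideal_eq|->].
Qed.

Definition gideal_cap S : gideal A.
Proof.
unshelve refine (@GIdeal _ _ A
  (@Ideal U [set x | forall J, S J -> J x] _ _ _ _) _).
- by move=> J _; apply: ideal0.
- by move=> x y Ix Iy J SJ; apply: idealD; [apply: Ix | apply: Iy].
- by move=> u x Ix J SJ; apply: idealMl; apply: Ix.
- by move=> x u Ix J SJ; apply: idealMr; apply: Ix.
- by move=> g x Ix J SJ; apply: gideal_stable; apply: Ix.
Defined.

End FiniteFamilies.

Lemma closure_specP (U : pzRingType) (P Q : spec U) :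
  closure [set P] Q <-> P `<=` Q.
Proof.
split=> [clQ x Px|PQ B].
  apply: contrapT => Qx.
  have [|_ [-> /=]] := clQ (~` zero_locus [set x]).
    apply: open_nbhs_nbhs; split; last by move=> /(_ x erefl).
    by exists [set x]; rewrite setCK.
  by apply=> y ->.
rewrite nbhsE => -[O [[S OE] OQ] OB]; exists P; split=> //; apply: OB.
apply: contrapT => OP; have : (~` O) P by [].
by rewrite OE => SP; have : (~` O) Q by rewrite OE => x /SP /PQ.
Qed.

(** * The equivalences *)

Section DixmierMoeglin.
Variables (k : closedFieldType) (G : affine_group k) (R : algType k).
Variable A : ring_action G R.
Hypothesis A_linear : forall g, scalable (A g).
Hypothesis A_rational : rational_action A.
Hypothesis R_null : nullstellensatz R.
Implicit Types (I J : gideal A) (P Q : spec R).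

Lemma primitive_prime (M : ideal R) : primitive_ideal M -> prime_ideal M.
Proof. by move=> [V [Vs MV]]; apply: simple_module_ann_prime Vs _ MV. Qed.

Lemma primitive_rational P : primitive_ideal P -> RatSpec R P.
Proof.
move=> [V [Vs PV]]; apply/RatSpecP.
exact: simple_module_ann_rational Vs _ PV (R_null.2 V Vs).
Qed.

Lemma primitive_cap P s : ~ P s ->
  exists Q, [/\ primitive_ideal Q, P `<=` Q & ~ Q s].
Proof.
have [S [Sprim PE]] := R_null.1 P; rewrite PE.
move=> /existsNP[M /not_implyP[SM Ms]].
exists (Spec (primitive_prime (Sprim M SM))); split=> //.
  exact: (Sprim M SM).
by move=> x; apply.
Qed.

Lemma rational_cap P x :
  (forall Q, RatSpec R Q -> P `<=` Q -> Q x) -> P x.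
Proof.
move=> Px; apply: contrapT => /primitive_cap[Q [/primitive_rational Qrat PQ]].
by apply; apply: Px.
Qed.

Lemma gspec_core I : GSpec A I -> exists P, I = core A P.
Proof.
move=> Iprime; have [P [IP PI _]] :=
  maximal_core A_linear A_rational Iprime (@core_sub _ _ A I).
by exists P; apply: gideal_eq; apply/seteqP; split=> //; apply: sub_core.
Qed.

Definition translate g P : spec R := Spec (prime_translate A g (spec_prime P)).

Lemma translate_rational g P : RatSpec R P -> RatSpec R (translate g P).
Proof.
move=> /RatSpecP Prat; apply/RatSpecP.
exact: rational_at_translate A_linear _ _ Prat.
Qed.

Lemma gspec_rational_cap I x : GSpec A I ->
  (forall Q, RatSpec R Q -> I `<=` Q -> Q x) -> I x.
Proof.
move=> /gspec_core[P ->] Ix g; apply: rational_cap => Q Qrat PQ.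
apply: (Ix (translate g Q)); first exact: translate_rational.
by move=> y Py; apply: PQ; apply: Py.
Qed.

Lemma maximal_rational I P : GRatSpec A I -> I `<=` P -> core A P `<=` I ->
  (forall L : ideal R, P `<=` L -> core A L `<=` I -> L `<=` P) -> RatSpec R P.
Proof.
move=> Irat IP PI Pmax.
apply: (maximal_core_rational A_linear A_rational Irat IP PI Pmax) => x Ix.
by apply: gspec_rational_cap Ix; case: Irat.
Qed.

(** [Q] lies in a prime [Q'] maximal with core inside that of [P]. This [Q'] is rational with the
    same core as [P], hence a translate of [P], and a translate of [P] containing [P] equals [P]. *)
Lemma rational_core_eq P Q :
  RatSpec R P -> P `<=` Q -> core A Q `<=` core A P -> Q = P.
Proof.
move=> Prat PQ QP; have Irat := core_grational A_linear Prat.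
have Iprime : GSpec A (core A P) by case: Irat.
have [Q' [QQ' Q'I Q'max]] := maximal_core A_linear A_rational Iprime QP.
have IQ' : core A P `<=` Q' by move=> x /core_sub /PQ /QQ'.
have Q'rat := maximal_rational Irat IQ' Q'I Q'max.
have coreE : core A P = core A Q'.
  by apply: gideal_eq; apply/seteqP; split=> //; apply: sub_core.
have [g Q'E] := rational_same_orbit A_linear A_rational Prat Q'rat coreE.
have Pg x : P x -> P (A g^-1%g x).
  by move=> /PQ /QQ'; rewrite Q'E => /spec_actE.
have Pg' x : P x -> P (A g x).
  by move=> /(stable_under_inverse A_linear A_rational Pg); rewrite invgK.
apply: spec_eq => x; split=> [/QQ'|/PQ//].
by rewrite Q'E => /spec_actE /Pg'; rewrite actVK.
Qed.

Lemma spec_orbitE g P : spec_orbit A (spec_act A g P) = spec_orbit A P.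
Proof.
have actA h l Q : spec_act A h (spec_act A l Q) = spec_act A (h * l)%g Q.
  apply: spec_eq => x; rewrite spec_actE [X in X <-> _]spec_actE spec_actE.
  by rewrite invgM actM.
apply/seteqP; split=> Q [h _ <-].
  by exists (h * g)%g; rewrite ?actA.
by exists (h * g^-1)%g; rewrite ?actA ?mulgVK.
Qed.

Lemma core_translate g P : core A (spec_act A g P) = core A P.
Proof.
apply: gideal_eq; apply/seteqP; split=> x Px h.
  by have /spec_actE := Px (g * h)%g; rewrite -actM mulgA mulVg mul1g.
by apply/spec_actE; rewrite -actM.
Qed.

Lemma gspec_semiprime I : GSpec A I -> semiprime_ideal I.
Proof.
move=> Iprime; exists [set P : spec R | I `<=` P]; apply/seteqP.
split=> [x Ix P IP|x Ix]; first exact: IP.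
by apply: gspec_rational_cap => // Q _ IQ; apply: Ix.
Qed.

Lemma gideal_cap_semiprime (S : set (gideal A)) : S `<=` GSpec A ->
  semiprime_ideal (gideal_cap S).
Proof.
move=> SG; exists [set P : spec R | gideal_cap S `<=` P]; apply/seteqP.
split=> [x Ix P IP|x Ix J SJ]; first exact: IP.
apply: gspec_rational_cap (SG J SJ) _ => Q _ JQ; apply: Ix => y Sy.
exact/JQ/Sy.
Qed.

Definition rational_cores : set (gideal A) := (fun P => core A P) @` RatSpec R.

Lemma semiprime_rational_cores I x : semiprime_ideal I ->
  (forall J, rational_cores J -> I `<=` J -> J x) -> I x.
Proof.
move=> [S IE] Ix; rewrite IE => P SP; apply: rational_cap => Q Qrat PQ.
apply: (@core_sub _ _ A); apply: Ix; first by exists Q.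
by apply: sub_core => y; rewrite IE => /(_ P SP) /PQ.
Qed.

Lemma finite_semiprime_gspec :
  finite_set [set I : gideal A | semiprime_ideal I] -> finite_set (GSpec A).
Proof. by apply: sub_finite_set; apply: gspec_semiprime. Qed.

Lemma finite_gspec_grat : finite_set (GSpec A) -> finite_set (GRatSpec A).
Proof. by apply: sub_finite_set => I []. Qed.

Lemma finite_grat_orbits :
  finite_set (GRatSpec A) -> finite_set (spec_orbit A @` RatSpec R).
Proof.
move=> Gfin; apply: (@finite_image_factor _ _ _ (fun P => core A P)).
  move=> P Q Prat Qrat PQ.
  have [g ->] := rational_same_orbit A_linear A_rational Prat Qrat PQ.
  by rewrite spec_orbitE.
by apply: sub_finite_set Gfin => _ [P Prat <-]; apply: core_grational.
Qed.

Lemma finite_orbits_cores :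
  finite_set (spec_orbit A @` RatSpec R) -> finite_set rational_cores.
Proof.
apply: finite_image_factor => P Q _ _ PQ.
have : spec_orbit A Q P by rewrite -PQ; exists 1%g => //; apply: spec_eq => x;
  rewrite spec_actE invg1 act1.
by move=> [g _ <-]; rewrite core_translate.
Qed.

Lemma finite_cores_semiprime : finite_set rational_cores ->
  finite_set [set I : gideal A | semiprime_ideal I].
Proof.
move=> /finite_gideal_caps; apply: sub_finite_set => I Isemi x.
exact: semiprime_rational_cores.
Qed.

Lemma finite_cores_separating I : finite_set rational_cores -> GSpec A I ->
  exists s, ~ I s /\ forall Q, RatSpec R Q -> I `<=` Q -> Q s \/ core A Q = I.
Proof.
move=> /finite_seqP[l lE] Iprime; have [s [Is sP]] := gspec_separating l Iprime.
exists s; split=> // Q Qrat IQ; have IcQ := sub_core IQ.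
have [QI|QI] := pselect (core A Q `<=` I).
  by right; apply: gideal_eq; apply/seteqP.
left; apply: (@core_sub _ _ A); apply: sP => //.
have : rational_cores (core A Q) by exists Q.
by rewrite lE.
Qed.

(** If a [G]-prime were not the core of a rational prime, all rational primes over it would share an
    [s] outside it, although it is their intersection. *)
Lemma finite_cores_gspec : finite_set rational_cores -> GRatSpec A = GSpec A.
Proof.
move=> Cfin; apply/seteqP; split=> [I []//|I Iprime].
have [s [Is sP]] := finite_cores_separating Cfin Iprime.
apply: contrapT => nI; apply: Is; apply: gspec_rational_cap => // Q Qrat IQ.
by have [//|QI] := sP Q Qrat IQ; case: nI; rewrite -QI; apply: core_grational.
Qed.

Lemma locally_closed_separating P : locally_closed P ->
  exists s, ~ P s /\ forall Q, P `<=` Q -> Q = P \/ Q s.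
Proof.
move=> [O [[S OE] OP]].
have [OinP _] : (O `&` closure [set P]) P by rewrite OP.
have [s [Ss Ps]] : exists s, S s /\ ~ P s.
  apply: contrapT => nos; suff : (~` O) P by [].
  rewrite OE => s Ss; apply: contrapT => Ps; apply: nos.
  by exists s.
exists s; split=> // Q PQ; have [OQ|OQ] := pselect (O Q); last first.
  by right; have : (~` O) Q by []; rewrite OE => /(_ s Ss).
left; suff : (O `&` closure [set P]) Q by rewrite OP.
by split=> //; apply/closure_specP.
Qed.

Lemma locally_closed_primitive P : locally_closed P -> primitive_ideal P.
Proof.
move=> /locally_closed_separating[s [/primitive_cap[Q [Qprim PQ Qs]] sP]].
by have [<-|/Qs] := sP Q PQ.
Qed.

(** With [s] separating the core of [P], a prime over [P] of larger core contains every translate of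
    [s], and one of the same core is [P] itself. So a translate of [s] outside [P] isolates [P] in
    its closure. *)
Lemma finite_cores_locally_closed P : finite_set rational_cores ->
  RatSpec R P -> locally_closed P.
Proof.
move=> Cfin Prat; have Iprime := core_prime A (spec_prime P).
have [s [/existsNP[g Ps] sP]] := finite_cores_separating Cfin Iprime.
exists (~` zero_locus [set A g s]); split.
  by exists [set A g s]; rewrite setCK.
apply/seteqP; split=> [Q [Qs /closure_specP PQ]|_ ->]; last first.
  by split; [move=> /(_ _ erefl) | apply/closure_specP].
apply: rational_core_eq => //.
apply: contrapT => nQP; apply: Qs => _ ->; apply: rational_cap => Q' Q'rat QQ'.
have IQ' : core A P `<=` translate g Q'.
  by move=> x Px; apply: QQ'; apply: PQ; apply: Px.
have [//|Q'I] := sP _ (translate_rational g Q'rat) IQ'.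
case: nQP; rewrite -Q'I => x Qx h; apply: QQ'.
by rewrite -actM; apply: Qx.
Qed.

Lemma finite_orbits_noetherian :
  finite_set (spec_orbit A @` RatSpec R) ->
  [/\ acc_gsemiprime A, dixmier_moeglin R & GRatSpec A = GSpec A].
Proof.
move=> /finite_orbits_cores Cfin; split; last exact: finite_cores_gspec.
  move=> I Isemi.
  apply: (@finite_gideal_acc _ _ _ [set I : gideal A | semiprime_ideal I]) => //.
  exact: finite_cores_semiprime.
move=> P; tfae.
- exact: locally_closed_primitive.
- exact: primitive_rational.
- exact: finite_cores_locally_closed.
Qed.

(** Three elements combine: [s0] isolates a rational [P] with core [I] in its closure, [t] outside
    [I] has its orbit in [P + (s0)], and rational primes over [I] that avoid [x] contain a translate
    of [P]. Such a prime either is that translate, which cannot lie over [J], or contains every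
    translate of [t]. *)
Lemma grational_separating I :
  (forall P, RatSpec R P -> locally_closed P) -> GRatSpec A I ->
  exists s, ~ I s /\
    forall J, GSpec A J -> I `<=` J -> ~ J `<=` I -> J s.
Proof.
move=> rat_lc Irat; have Iprime : GSpec A I by case: Irat.
have [P [IP PI Pmax]] :=
  maximal_core A_linear A_rational Iprime (@core_sub _ _ A I).
have Prat := maximal_rational Irat IP PI Pmax.
have [s0 [Ps0 s0P]] := locally_closed_separating (rat_lc P Prat).
pose L := ideal_add P (ideal_gen [set s0]).
have PL : P `<=` L.
  by move=> x Px; exists x, 0; rewrite addr0; split=> //; apply: ideal0.
have [t [Lt It]] : exists t, core A L t /\ ~ I t.
  apply: contrapT => not; apply: Ps0; apply: (Pmax L) => //.
    by move=> x Lx; apply: contrapT => Ix; apply: not; exists x.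
  by exists 0, s0; rewrite add0r; split=> // [|M]; [apply: ideal0 | apply].
have [x [Px xP]] := orbit_dominates (@in_algC k R)
  (rational_orbit_regular A_linear A_rational) (spec_prime P).
have [g [y Ixyt]] : exists g y, ~ I (x * y * A g t).
  apply: contrapT => nogy.
  have [g y||//] := gprimeM (u := x) (a := t) Iprime.
    by apply: contrapT => Ixyt; apply: nogy; exists g, y.
  by move=> Ix; apply: Px => h; apply/IP/gideal_stable.
exists (x * y * A g t); split=> // J Jprime IJ JI.
apply: gspec_rational_cap => // Q /RatSpecP Qrat JQ.
have [Qx|Qx] := pselect (Q x); first by apply: idealMr; apply: idealMr.
apply: idealMl.
have [z Pz|h PhQ] := xP Q (spec_prime Q) Qrat _ Qx.
  by apply/JQ/IJ/PI.
have [QP|Qs0] := s0P (translate h Q) PhQ.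
  case: JI => z Jz; apply: PI => l; rewrite -QP.
  by apply/JQ/gideal_stable/gideal_stable.
have LQ : L `<=` translate h Q.
  move=> _ [p [q [Pp Lq ->]]]; apply: idealD; first exact: PhQ.
  by apply: Lq => _ ->.
have : translate h Q (A (h^-1 * g)%g t) by apply: LQ; apply: Lt.
by rewrite /translate /= /mkset -actM mulVKg.
Qed.

(** Noetherian induction on semiprime ideals with infinitely many [G]-primes above: each lies
    properly inside another one, obtained by intersecting an infinite subfamily of these
    [G]-primes. *)
Lemma acc_finite_gspec : acc_gsemiprime A ->
  (forall I, GSpec A I -> exists s, ~ I s /\
    forall J, GSpec A J -> I `<=` J -> ~ J `<=` I -> J s) ->
  finite_set (GSpec A).
Proof.
move=> acc sep; pose V I := [set J | GSpec A J /\ I `<=` J].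
pose bad I := semiprime_ideal I /\ ~ finite_set (V I).
have step (I : {I | bad I}) : exists J : {I | bad I},
    sval I `<=` sval J /\ ~ sval J `<=` sval I.
  case: I => I [Isemi Iinf] /=.
  have badcap (S : set (gideal A)) : S `<=` V I -> ~ finite_set S ->
      bad (gideal_cap S).
    move=> SV Sinf; split; first by apply: gideal_cap_semiprime => J /SV[].
    apply: contra_not Sinf; apply: sub_finite_set => J SJ.
    by split; [case: (SV J SJ) | move=> x; apply].
  have caps (S : set (gideal A)) : S `<=` V I -> ~ finite_set S ->
      ~ gideal_cap S `<=` I -> exists J : {I | bad I},
        I `<=` sval J /\ ~ sval J `<=` I.
    move=> SV Sinf SI; exists (exist _ _ (badcap S SV Sinf)); split=> //=.
    by move=> x Ix J /SV[_]; apply.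
  have [Iprime|nIprime] := pselect (GSpec A I).
    (* The [G]-primes strictly above [I] all contain [s], so their intersection is larger than
       [I]. *)
    have [s [Is sP]] := sep I Iprime.
    apply: (caps (V I `&` [set J | ~ J `<=` I])).
    - by move=> J [].
    - apply: contra_not Iinf => fin.
      have : finite_set ([set I] `|` V I `&` [set J | ~ J `<=` I]).
        by rewrite finite_setU; split=> //; apply: finite_set1.
      apply: sub_finite_set => J [Jprime IJ].
      have [JI|JI] := pselect (J `<=` I); last by right.
      by left; apply: gideal_eq; apply/seteqP.
    - by move=> /(_ s) capI; apply/Is/capI => J [[Jprime IJ]]; apply: sP.
  have [IT|IT] := pselect (I = setT :> set R).
    case: Iinf; apply: (@sub_finite_set _ _ set0); last exact: finite_set0.
    by move=> J [[JT _] IJ]; apply: JT; apply/seteqP; split=> //; rewrite -IT.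
  (* When [I] is proper but not [G]-prime, every [G]-prime over it contains [B1] or [B2]; one of the
     two subfamilies is infinite, and its intersection is larger than [I]. *)
  have [B1 [B2 [B12 B1I B2I]]] : exists B1 B2 : gideal A,
      [/\ ideal_mul B1 B2 `<=` I, ~ B1 `<=` I & ~ B2 `<=` I].
    apply: contrapT => noB; apply: nIprime; split=> // B1 B2 B12.
    by apply: contrapT => /not_orP[? ?]; apply: noB; exists B1, B2.
  pose W (B : gideal A) := V I `&` [set J | B `<=` J].
  have capW (B : gideal A) : ~ B `<=` I -> ~ gideal_cap (W B) `<=` I.
    by move=> BI capI; apply: BI => x Bx; apply: capI => J [_]; apply.
  have [fin1|inf1] := pselect (finite_set (W B1)); last first.
    by apply: (caps (W B1)) => //; [move=> J [] | apply: capW].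
  apply: (caps (W B2)); [by move=> J [] | | exact: capW].
  apply: contra_not Iinf => fin2.
  have : finite_set (W B1 `|` W B2) by rewrite finite_setU.
  apply: sub_finite_set => J [Jprime IJ].
  by have [|BJ|BJ] := Jprime.2 B1 B2; [move=> x /B12 /IJ | left | right].
apply: contrapT => Ginf.
have bad0 : bad (gideal_cap (GSpec A)).
  split; first exact: gideal_cap_semiprime.
  apply: contra_not Ginf; apply: sub_finite_set => J GJ; split=> // x; exact.
have [next nextP] := choice step.
pose u n := iter n next (exist _ _ bad0).
have [|n|N uN] := acc (fun n => sval (u n)).
- by move=> n; case: (svalP (u n)).
- exact: (nextP (u n)).1.
have [_] := nextP (u N); apply.
by rewrite -[sval (next _)]/(sval (u N.+1)) (uN N.+1).
Qed.

Lemma noetherian_finite_semiprime :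
  [/\ acc_gsemiprime A, dixmier_moeglin R & GRatSpec A = GSpec A] ->
  finite_set [set I : gideal A | semiprime_ideal I].
Proof.
move=> [acc DM Grat].
have /finite_gideal_caps : finite_set (GSpec A).
  apply: acc_finite_gspec => // I Iprime.
  apply: grational_separating; last by rewrite Grat.
  (* Counted from zero, entries [2] and [0] of the equivalence are [RatSpec] and
     [locally_closed]. *)
  by move=> P; exact: (iffLR (DM P 2 0)).
apply: sub_finite_set => I [S IE] x Ix; rewrite IE => P SP.
apply: (@core_sub _ _ A); apply: Ix; first exact: core_prime (spec_prime P).
by apply: sub_core => y; rewrite IE; apply.
Qed.

Lemma rational_maximal_in_stratum P : RatSpec R P -> maximal_in_stratum A P.
Proof.
move=> Prat; exists (core A P).
split; [exact: core_prime (spec_prime P) | exact/stratumE |].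
move=> Q /stratumE PQ QP; apply: rational_core_eq => //.
by rewrite PQ.
Qed.

(** A prime [Q] over [P] that is maximal with core inside [I] is still in the stratum, so [Q = P]
    and [maximal_rational] applies. *)
Lemma maximal_in_stratum_rational P :
  GRatSpec A = GSpec A -> maximal_in_stratum A P -> RatSpec R P.
Proof.
move=> Grat [I [Iprime /stratumE IP Pmax]].
have cPI : core A P `<=` I by rewrite IP.
have [Q [PQ QI Qmax]] := maximal_core A_linear A_rational Iprime cPI.
have QP : Q = P.
  apply: Pmax => //; apply/stratumE; apply: gideal_eq; apply/seteqP; split=> //.
  by rewrite IP; apply: core_mono.
apply: (@maximal_rational I); rewrite -?QP //; first by rewrite Grat.
by rewrite IP => x /core_sub /PQ.
Qed.

End DixmierMoeglin.

Theorem proposition14 (k : closedFieldType) (G : affine_group k)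
    (R : algType k) (A : ring_action G R)
    (A_linear : forall g, scalable (A g))
    (A_rational : rational_action A)
    (R_nullstellensatz : nullstellensatz R) :
  [<-> finite_set [set I : gideal A | semiprime_ideal I];
       finite_set (GSpec A);
       finite_set (GRatSpec A);
       finite_set (spec_orbit A @` RatSpec R);
       [/\ acc_gsemiprime A, dixmier_moeglin R & GRatSpec A = GSpec A]] /\
  (finite_set [set I : gideal A | semiprime_ideal I] ->
     forall P : spec R, RatSpec R P <-> maximal_in_stratum A P).
Proof.
have ab := finite_semiprime_gspec A_linear A_rational R_nullstellensatz.
have bc := @finite_gspec_grat _ _ _ A.
have cd := finite_grat_orbits A_linear A_rational.
have de := finite_orbits_noetherian A_linear A_rational R_nullstellensatz.
have ea := noetherian_finite_semiprime A_linear A_rational R_nullstellensatz.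
split; first by tfae.
move=> /ab /bc /cd /de [_ _ Grat] P; split.
  exact: rational_maximal_in_stratum.
exact: maximal_in_stratum_rational.
Qed.
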